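(* Let $Y$ be a cofibrant $\mathsf{K}$-coalgebra. Then $Y$ is weakly equivalent, via derived $\mathsf{K}$-coalgebra maps, to the integral chains $\tilde{\mathbb{Z}}X$ of some $1$-connected pointed space $X$ if and only if $Y$ is $1$-connected.
   Context: ''Space'' means simplicial set. $\mathsf{S}_*$ is the category of pointed simplicial sets, $\mathsf{sAb}$ the category of simplicial abelian groups with its usual simplicial model structure, and $\tilde{\mathbb{Z}}:\mathsf{S}_*\rightleftarrows\mathsf{sAb}:U$ the free-forgetful adjunction, $\tilde{\mathbb{Z}}(X)=\mathbb{Z}(X)/\mathbb{Z}( * )$, with unit $\eta$ (the Hurewicz map). $\mathsf{K}=\tilde{\mathbb{Z}}U$ is the associated comonad on $\mathsf{sAb}$, with comultiplication $m=\tilde{\mathbb{Z}}\eta U$ and counit the counit of the adjunction. A $\mathsf{K}$-coalgebra is an object $Y$ of $\mathsf{sAb}$ with a coassociative counital coaction $m:Y\to\mathsf{K}Y$. For $X\in\mathsf{S}_*$, $\tilde{\mathbb{Z}}X$ is a $\mathsf{K}$-coalgebra via $\tilde{\mathbb{Z}}\eta:\tilde{\mathbb{Z}}X\to\mathsf{K}\tilde{\mathbb{Z}}X$. A $\mathsf{K}$-coalgebra is cofibrant if its underlying object of $\mathsf{sAb}$ is cofibrant (every $\tilde{\mathbb{Z}}X$ is cofibrant) and $1$-connected if its underlying simplicial set is $1$-connected. $\mathbf{Hom}_{\mathsf{sAb}}(Y,Y')$ is the simplicial mapping space with $n$-simplices the maps $Y\otimes\mathbb{Z}\Delta[n]\to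 Y'$ in $\mathsf{sAb}$. For cofibrant $\mathsf{K}$-coalgebras $Y,Y'$, $\mathbf{Hom}_{\mathsf{sAb}}(Y,\mathsf{K}^\bullet Y')$ is the cosimplicial simplicial set with $n$-th term $\mathbf{Hom}_{\mathsf{sAb}}(Y,\mathsf{K}^nY')$, where $d^0f=(\mathsf{K}f)\circ m_Y$ ($\mathsf{K}$ is a simplicial functor), $d^i$ ($1\le i\le n$) is induced by comultiplication on the $i$-th $\mathsf{K}$, $d^{n+1}$ by the coaction of $Y'$, and codegeneracies by the counit. Let $\Delta_{\mathsf{res}}\subset\Delta$ be the subcategory of strictly monotone maps. A derived $\mathsf{K}$-coalgebra map $f$ from $Y$ to $Y'$ is a map $f:\Delta[-]\to\mathbf{Hom}_{\mathsf{sAb}}(Y,\mathsf{K}^\bullet Y')$ of $\Delta_{\mathsf{res}}$-diagrams of simplicial sets. Its underlying map $f_0:Y\to Y'$ is the one picked out by $\Delta[0]\to\mathbf{Hom}_{\mathsf{sAb}}(Y,Y')$, and $f$ is a weak equivalence if $f_0$ is a weak equivalence. Two cofibrant $\mathsf{K}$-coalgebras are weakly equivalent via derived $\mathsf{K}$-coalgebra maps if they are connected by a finite zigzag of derived $\mathsf{K}$-coalgebra maps that are weak equivalences. *)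

(* Defs.v *)
From Stdlib Require Import Relation_Operators.
From HB Require Import structures.
From mathcomp Require Import freeg.
From mathcomp Require Import all_boot all_algebra ring_quotient boolp.

Set Implicit Arguments.
Unset Strict Implicit.
Unset Printing Implicit Defensive.

Import GRing.Theory.

Section GeneratedQuotient.
Local Open Scope ring_scope.
Local Open Scope quotient_scope.
Variables (V : zmodType) (S : V -> Prop).

(* Membership in the subgroup generated by S. *)
Definition gen_sub : pred V :=
  fun v => `[< forall P : zmodClosed V, (forall s, S s -> s \in P) -> v \in P >].

Lemma gen_sub_closed : zmod_closed gen_sub.
Proof.
split=> [|u v /asboolP hu /asboolP hv]; apply/asboolP => P hP; first exact: rpred0.
by apply: rpredB; [apply: hu|apply: hv].
Qed.

Definition gen_subgroup : zmodClosed V :=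
  HB.pack gen_sub (GRing.isZmodClosed.Build V gen_sub gen_sub_closed).

Definition gquot : zmodType := Quotient.quot gen_subgroup.

Definition gpi (v : V) : gquot := \pi v.

Lemma gpi_zmod : zmod_morphism gpi.
Proof. by move=> u v; rewrite /gpi raddfB. Qed.

HB.instance Definition _ := GRing.isZmodMorphism.Build V gquot gpi gpi_zmod.

Lemma gquot_ind (P : gquot -> Prop) : (forall v, P (gpi v)) -> forall q, P q.
Proof. by move=> h q; rewrite -[q]reprK; apply: h. Qed.

Lemma gpi_eq u v : S (u - v) -> gpi u = gpi v.
Proof.
move=> h; apply/eqP; rewrite -Quotient.idealrBE.
by apply/asboolP => P; apply.
Qed.

Lemma gpi_eq0 v : S v -> gpi v = 0.
Proof. by move=> h; rewrite -(raddf0 gpi); apply: gpi_eq; rewrite subr0. Qed.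

Section Lift.
Variables (W : zmodType) (f : V -> W).

Definition glift (q : gquot) : W := f (repr q).

Hypotheses (fB : zmod_morphism f) (fS : forall s, S s -> f s = 0).

Lemma gliftE v : glift (gpi v) = f v.
Proof.
pose P : pred V := fun v => f v == 0.
have f0 : f 0 = 0 by rewrite -(subrr 0) fB subrr.
have PP : zmod_closed P.
  split; first by apply/eqP.
  by move=> a b /eqP ha /eqP hb; apply/eqP; rewrite fB ha hb subrr.
pose Pc := GRing.isZmodClosed.Build V P PP.
pose Q : zmodClosed V := HB.pack P Pc.
have : repr (gpi v) - v \in gen_subgroup by rewrite Quotient.idealrBE reprK.
move=> /asboolP /(_ Q) h; apply/eqP; rewrite -subr_eq0 /glift -fB.
by apply: h => s /fS hs; apply/eqP.
Qed.

Lemma glift_zmod : zmod_morphism glift.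
Proof.
by elim/gquot_ind => u; elim/gquot_ind => v; rewrite -raddfB !gliftE fB.
Qed.

End Lift.

End GeneratedQuotient.

Section FreeAbelian.
Local Open Scope ring_scope.

Definition zab (T : Type) : zmodType := {freeg {classic T} / int}.

Definition zgen (T : Type) (x : T) : zab T := << (x : {classic T}) >>.

Definition zlift (T : Type) (M : zmodType) (f : T -> M) : zab T -> M :=
  @fglift int (zmodule M) {classic T} f.

Variables (T : Type) (M : zmodType).

Lemma zliftE (f : T -> M) x : zlift f (zgen x) = f x.
Proof. by rewrite /zlift /zgen liftU scale1r. Qed.

Lemma zlift_zmod (f : T -> M) : zmod_morphism (zlift f).
Proof. exact: (@lift_is_additive int {classic T} (zmodule M) f). Qed.

Lemma zab_ext (f g : zab T -> M) : zmod_morphism f -> zmod_morphism g ->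
  (forall x, f (zgen x) = g (zgen x)) -> f =1 g.
Proof.
move=> fB gB fg D.
pose fc := GRing.isZmodMorphism.Build _ _ f fB.
pose gc := GRing.isZmodMorphism.Build _ _ g gB.
pose F : {additive zab T -> M} := HB.pack f fc.
pose G : {additive zab T -> M} := HB.pack g gc.
suff : F D = G D by [].
rewrite -[D]freeg_sumE !raddf_sum; apply: eq_bigr => x _.
have -> : << coeff x D *g x >> = zgen x *~ coeff x D :> zab T.
  by rewrite /zgen freegU_mulz intz.
by rewrite !raddfMz; congr (_ *~ _); apply: fg.
Qed.

End FreeAbelian.

Lemma zmod_morphism_comp (A B C : zmodType) (g : B -> C) (f : A -> B) :
  zmod_morphism g -> zmod_morphism f -> zmod_morphism (g \o f).
Proof. by move=> gB fB u v; rewrite /= fB gB. Qed.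

Lemma zmod_morphism0 (A B : zmodType) (f : A -> B) :
  zmod_morphism f -> f 0%R = 0%R.
Proof. by move=> fB; rewrite -(subrr 0%R) fB subrr. Qed.

Lemma zmod_morphismD (A B : zmodType) (f : A -> B) :
  zmod_morphism f -> {morph f : x y / (x + y)%R}.
Proof.
move=> fB x y; have fN : f (- y)%R = (- f y)%R.
  by rewrite -[(- y)%R]sub0r fB (zmod_morphism0 fB) sub0r.
by rewrite -[in LHS](opprK y) fB fN opprK.
Qed.

Section ReducedFree.
Local Open Scope ring_scope.

Definition zred (T : Type) (pt : T) : zmodType :=
  gquot (fun v : zab T => v = zgen pt).

Variables (T : Type) (pt : T).

Definition zcl (x : T) : zred pt := gpi _ (zgen x).

Lemma zcl_pt : zcl pt = 0.
Proof. exact: gpi_eq0. Qed.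

Variable M : zmodType.

Definition zrlift (f : T -> M) : zred pt -> M := glift (zlift f).

Lemma zrlift_pt (f : T -> M) : f pt = 0 -> forall s, s = zgen pt -> zlift f s = 0.
Proof. by move=> f0 s ->; rewrite zliftE. Qed.

Lemma zrliftE (f : T -> M) : f pt = 0 -> forall x, zrlift f (zcl x) = f x.
Proof.
move=> f0 x; rewrite /zrlift gliftE ?zliftE //; first exact: zlift_zmod.
exact: zrlift_pt.
Qed.

Lemma zrlift_zmod (f : T -> M) : f pt = 0 -> zmod_morphism (zrlift f).
Proof.
by move=> f0; apply: glift_zmod; [apply: zlift_zmod|apply: zrlift_pt].
Qed.

Lemma zred_ext (f g : zred pt -> M) : zmod_morphism f -> zmod_morphism g ->
  (forall x, f (zcl x) = g (zcl x)) -> f =1 g.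
Proof.
move=> fB gB fg; elim/gquot_ind; apply: zab_ext => //.
  exact: (zmod_morphism_comp fB (@gpi_zmod _ _)).
exact: (zmod_morphism_comp gB (@gpi_zmod _ _)).
Qed.

End ReducedFree.

Section Tensor.
Local Open Scope ring_scope.

(* The tensor product over Z. *)
Inductive tens_rel (A B : zmodType) : zab (A * B) -> Prop :=
| TensDl a a' b : tens_rel (zgen (a + a', b) - (zgen (a, b) + zgen (a', b)))
| TensDr a b b' : tens_rel (zgen (a, b + b') - (zgen (a, b) + zgen (a, b'))).

Definition tens (A B : zmodType) : zmodType := gquot (@tens_rel A B).

Variables (A B : zmodType).

Definition tmk (a : A) (b : B) : tens A B := gpi _ (zgen (a, b)).

Lemma tmkDl a a' b : tmk (a + a') b = tmk a b + tmk a' b.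
Proof. by rewrite /tmk -raddfD; apply: gpi_eq; constructor. Qed.

Lemma tmkDr a b b' : tmk a (b + b') = tmk a b + tmk a b'.
Proof. by rewrite /tmk -raddfD; apply: gpi_eq; constructor. Qed.

Lemma tmkBl b : zmod_morphism (tmk^~ b).
Proof. by move=> x y; apply/eqP; rewrite eq_sym subr_eq -tmkDl subrK. Qed.

Lemma tmkBr a : zmod_morphism (tmk a).
Proof. by move=> x y; apply/eqP; rewrite eq_sym subr_eq -tmkDr subrK. Qed.

Variable M : zmodType.

Definition tlift (f : A -> B -> M) : tens A B -> M :=
  glift (zlift (fun ab : A * B => f ab.1 ab.2)).

Section TLift.
Variable f : A -> B -> M.
Hypotheses (fl : forall b, zmod_morphism (f^~ b)) (fr : forall a, zmod_morphism (f a)).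

Lemma tlift_rel s : tens_rel s -> zlift (fun ab : A * B => f ab.1 ab.2) s = 0.
Proof.
have zB := zlift_zmod (fun ab : A * B => f ab.1 ab.2).
by case=> *; rewrite zB (zmod_morphismD zB) !zliftE /= ?(zmod_morphismD (fl _))
  ?(zmod_morphismD (fr _)) subrr.
Qed.

Lemma tliftE a b : tlift f (tmk a b) = f a b.
Proof.
by rewrite /tlift gliftE ?zliftE //; [apply: zlift_zmod|apply: tlift_rel].
Qed.

Lemma tlift_zmod : zmod_morphism (tlift f).
Proof. by apply: glift_zmod; [apply: zlift_zmod|apply: tlift_rel]. Qed.

End TLift.

Lemma tens_ext (f g : tens A B -> M) : zmod_morphism f -> zmod_morphism g ->
  (forall a b, f (tmk a b) = g (tmk a b)) -> f =1 g.
Proof.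
move=> fB gB fg; elim/gquot_ind; apply: zab_ext.
- exact: (zmod_morphism_comp fB (@gpi_zmod _ _)).
- exact: (zmod_morphism_comp gB (@gpi_zmod _ _)).
by case.
Qed.

End Tensor.

Lemma tens_zab_ext (A M : zmodType) (T : Type) (f g : tens A (zab T) -> M) :
  zmod_morphism f -> zmod_morphism g ->
  (forall a x, f (tmk a (zgen x)) = g (tmk a (zgen x))) -> f =1 g.
Proof.
move=> fB gB fg; apply: tens_ext => // a; apply: zab_ext.
- exact: (zmod_morphism_comp fB (tmkBr a)).
- exact: (zmod_morphism_comp gB (tmkBr a)).
- exact: fg.
Qed.

Lemma tens_zred_zab_ext (M : zmodType) (S T : Type) (pt : S)
    (f g : tens (zred pt) (zab T) -> M) :
  zmod_morphism f -> zmod_morphism g ->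
  (forall s x, f (tmk (zcl pt s) (zgen x)) = g (tmk (zcl pt s) (zgen x))) ->
  f =1 g.
Proof.
move=> fB gB fg; apply: tens_zab_ext => // a x; move: a; apply: zred_ext.
- exact: (zmod_morphism_comp fB (tmkBl _)).
- exact: (zmod_morphism_comp gB (tmkBl _)).
- by move=> s; apply: fg.
Qed.

(* Morphisms [m] -> [n] of Delta. *)
Record dmap (m n : nat) := DMap {
  dmap_fun :> {ffun 'I_m.+1 -> 'I_n.+1};
  dmap_mono : [forall i : 'I_m.+1, forall j : 'I_m.+1, (i <= j) ==> (dmap_fun i <= dmap_fun j)] }.

HB.instance Definition _ m n := [isSub for @dmap_fun m n].
HB.instance Definition _ m n := [Choice of dmap m n by <:].

Lemma dmapP m n (t : dmap m n) (i j : 'I_m.+1) : i <= j -> t i <= t j.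
Proof. by move: (dmap_mono t) => /forallP/(_ i)/forallP/(_ j)/implyP; apply. Qed.

Lemma dmap_ext m n (s t : dmap m n) : s =1 t -> s = t.
Proof. by move=> st; apply/val_inj/ffunP. Qed.

Lemma mk_dmap_subproof m n (f : 'I_m.+1 -> 'I_n.+1) :
  (forall i j : 'I_m.+1, i <= j -> f i <= f j) ->
  [forall i : 'I_m.+1, forall j : 'I_m.+1,
    (i <= j) ==> ([ffun i => f i] i <= [ffun i => f i] j)].
Proof. by move=> h; do 2![apply/forallP => ?]; rewrite !ffunE; apply/implyP/h. Qed.

Definition mk_dmap m n (f : 'I_m.+1 -> 'I_n.+1)
  (h : forall i j : 'I_m.+1, i <= j -> f i <= f j) : dmap m n :=
  DMap (mk_dmap_subproof h).

Lemma mk_dmapE m n f h i : @mk_dmap m n f h i = f i.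
Proof. by rewrite ffunE. Qed.

Definition did n : dmap n n := @mk_dmap n n id (fun i j h => h).

Definition dcomp m n p (g : dmap n p) (f : dmap m n) : dmap m p :=
  @mk_dmap m p (g \o f) (fun i j h => dmapP g (dmapP f h)).

Definition dconst m : dmap m 0 := @mk_dmap m 0 (fun _ => ord0) (fun i j h => leqnn 0).

Lemma didE n i : did n i = i. Proof. exact: mk_dmapE. Qed.

Lemma dcompE m n p (g : dmap n p) (f : dmap m n) i : dcomp g f i = g (f i).
Proof. exact: mk_dmapE. Qed.

Lemma dcomp1l m n (f : dmap m n) : dcomp (did n) f = f.
Proof. by apply: dmap_ext => i; rewrite dcompE didE. Qed.

Lemma dcomp1r m n (f : dmap m n) : dcomp f (did m) = f.
Proof. by apply: dmap_ext => i; rewrite dcompE didE. Qed.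

Lemma dcompA m n p q (h : dmap p q) (g : dmap n p) (f : dmap m n) :
  dcomp h (dcomp g f) = dcomp (dcomp h g) f.
Proof. by apply: dmap_ext => i; rewrite !dcompE. Qed.

Lemma dmap_to0 m (f g : dmap m 0) : f = g.
Proof. by apply: dmap_ext => i; rewrite (ord1 (f i)) (ord1 (g i)). Qed.

Lemma lift_mono n (i : 'I_n.+2) (j k : 'I_n.+1) : j <= k -> lift i j <= lift i k.
Proof. by rewrite /= leq_bump2. Qed.

(* The coface d^i : [n] -> [n+1] that omits i. *)
Definition dcoface n (i : 'I_n.+2) : dmap n n.+1 := mk_dmap (@lift_mono n i).

Lemma dcofaceE n (i : 'I_n.+2) j : dcoface i j = lift i j.
Proof. exact: mk_dmapE. Qed.

Record sset := SSet {
  simplex :> nat -> Type;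
  sact : forall m n, dmap m n -> simplex n -> simplex m;
  sact_id : forall n x, sact (did n) x = x;
  sact_comp : forall m n p (g : dmap n p) (f : dmap m n) x,
    sact (dcomp g f) x = sact f (sact g x) }.

Definition face (X : sset) n (i : 'I_n.+2) (x : X n.+1) : X n := sact (dcoface i) x.

Record smap (X Y : sset) := SMap {
  smap_fun :> forall n, X n -> Y n;
  smap_nat : forall m n (t : dmap m n) x, smap_fun (sact t x) = sact t (smap_fun x) }.
Arguments smap_fun {X Y} _ n _.

Lemma smap_ext X Y (f g : smap X Y) : (forall n (x : X n), f n x = g n x) -> f = g.
Proof.
case: f => f fP; case: g => g gP /= fg.
have e : f = g by apply: functional_extensionality_dep => n; apply: funext => x.
by case: _ / e gP => gP; rewrite (Prop_irrelevance fP gP).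
Qed.

Definition smap_id X : smap X X := @SMap X X (fun n x => x) (fun _ _ _ _ => erefl).

Lemma smap_comp_subproof X Y Z (g : smap Y Z) (f : smap X Y) m n (t : dmap m n) x :
  g m (f m (sact t x)) = sact t (g n (f n x)).
Proof. by rewrite !smap_nat. Qed.

Definition smap_comp X Y Z (g : smap Y Z) (f : smap X Y) : smap X Z :=
  SMap (smap_comp_subproof g f).

Definition simp (n : nat) : sset :=
  @SSet (fun m => dmap m n) (fun m p t s => dcomp s t)
    (fun m s => dcomp1r s) (fun m p q g f s => dcompA s g f).

Definition simp_map m n (t : dmap m n) : smap (simp m) (simp n) :=
  @SMap (simp m) (simp n) (fun p s => dcomp t s) (fun p q r s => dcompA t s r).

Definition in_horn n (k : 'I_n.+1) m (s : dmap m n) : bool :=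
  [exists j : 'I_n.+1, (j != k) && [forall i : 'I_m.+1, s i != j]].

Lemma in_horn_comp n (k : 'I_n.+1) m p (s : dmap p n) (t : dmap m p) :
  in_horn k s -> in_horn k (dcomp s t).
Proof.
case/existsP => j /andP[jk /forallP h]; apply/existsP; exists j.
by rewrite jk; apply/forallP => i; rewrite dcompE.
Qed.

Definition horn_act n (k : 'I_n.+1) m p (t : dmap m p) (s : {s : dmap p n | in_horn k s}) :
    {s : dmap m n | in_horn k s} :=
  exist _ (dcomp (sval s) t) (in_horn_comp t (svalP s)).

Lemma horn_act_id n (k : 'I_n.+1) m (s : {s : dmap m n | in_horn k s}) :
  horn_act (did m) s = s.
Proof. by apply: val_inj; apply: dcomp1r. Qed.

Lemma horn_act_comp n (k : 'I_n.+1) m p q (g : dmap p q) (f : dmap m p)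
    (s : {s : dmap q n | in_horn k s}) :
  horn_act (dcomp g f) s = horn_act f (horn_act g s).
Proof. by apply: val_inj; apply: dcompA. Qed.

(* The horn Lambda^n_k: the simplices of Delta[n] whose image misses a vertex
   other than k. *)
Definition horn n (k : 'I_n.+1) : sset :=
  @SSet (fun m => {s : dmap m n | in_horn k s}) (horn_act (k := k))
    (@horn_act_id n k) (@horn_act_comp n k).

Definition horn_incl n (k : 'I_n.+1) : smap (horn k) (simp n) :=
  @SMap (horn k) (simp n) (fun m s => sval s) (fun _ _ _ _ => erefl).

Definition kan_fibration (X Y : sset) (p : smap X Y) : Prop :=
  forall n (k : 'I_n.+2) (u : smap (horn k) X) (v : smap (simp n.+1) Y),
    smap_comp p u = smap_comp v (horn_incl k) ->
  exists2 w : smap (simp n.+1) X,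
    smap_comp w (horn_incl k) = u & smap_comp p w = v.

(* The degeneracy of the vertex v in dimension n. *)
Definition degen (X : sset) n (v : X 0) : X n := sact (dconst n) v.

(* The n-simplices whose boundary is constant at v. *)
Definition sphere (X : sset) (v : X 0) n (x : X n) : Prop :=
  forall m (t : dmap m n), m < n -> sact t x = degen m v.

(* For a Kan complex X, pi_n(X, v) is the set of n-simplices x with sphere v x
   modulo this relation (for n = 0, the set of components). *)
Definition sphere_homotopic (X : sset) (v : X 0) n (x y : X n) : Prop :=
  exists w : X n.+1,
    [/\ face ord_max w = y, face (inord n) w = x &
        forall i : 'I_n.+2, i < n -> face i w = degen n v].

Definition pi_iso (X Y : sset) (f : smap X Y) : Prop :=
  forall n (v : X 0),
    (forall x x' : X n, sphere v x -> sphere v x' ->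
       sphere_homotopic (f 0 v) (f n x) (f n x') -> sphere_homotopic v x x') /\
    (forall y : Y n, sphere (f 0 v) y ->
       exists2 x : X n, sphere v x & sphere_homotopic (f 0 v) (f n x) y).

Section EdgePaths.
Variable X : sset.

(* (true, e) is the edge e traversed from d_1 e to d_0 e, and (false, e) is the
   same edge traversed backwards. *)
Definition oedge : Type := bool * X 1.
Definition osrc (a : oedge) : X 0 := face (if a.1 then ord_max else ord0) a.2.
Definition otgt (a : oedge) : X 0 := face (if a.1 then ord0 else ord_max) a.2.
Definition orev (a : oedge) : oedge := (~~ a.1, a.2).

Fixpoint edge_path (x : X 0) (p : seq oedge) (y : X 0) : Prop :=
  if p is a :: q then osrc a = x /\ edge_path (otgt a) q y else x = y.

Inductive edge_rel : seq oedge -> seq oedge -> Prop :=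
| EdgeCancel a : edge_rel [:: a; orev a] [::]
| EdgeDegen x : edge_rel [:: (true, degen 1 x)] [::]
| EdgeTriangle (s : X 2) :
    edge_rel [:: (true, face ord_max s); (true, face ord0 s)]
             [:: (true, face (inord 1) s)].

(* Equality in the fundamental groupoid, the free groupoid on the edges modulo
   s_0 x = id_x and d_2 s . d_0 s = d_1 s for every 2-simplex s. *)
Inductive path_homotopic (x y : X 0) : seq oedge -> seq oedge -> Prop :=
| PathStep l p q r : edge_rel p q ->
    edge_path x (l ++ p ++ r) y -> edge_path x (l ++ q ++ r) y ->
    path_homotopic x y (l ++ p ++ r) (l ++ q ++ r)
| PathRefl p : edge_path x p y -> path_homotopic x y p p
| PathSym p q : path_homotopic x y p q -> path_homotopic x y q p
| PathTrans p q r :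
    path_homotopic x y p q -> path_homotopic x y q r -> path_homotopic x y p r.

Definition one_connected : Prop :=
  [/\ exists x : X 0, True,
      forall x y : X 0, exists p, edge_path x p y &
      forall (x : X 0) p, edge_path x p x -> path_homotopic x x p [::]].

End EdgePaths.

Record psset := PSSet {
  psset_sset :> sset;
  bpt : forall n, psset_sset n;
  bpt_act : forall m n (t : dmap m n), sact t (bpt n) = bpt m }.
Arguments bpt _ n : clear implicits.

Record psmap (X Y : psset) := PSMap {
  psmap_smap :> smap X Y;
  psmap_pt : forall n, psmap_smap n (bpt X n) = bpt Y n }.

Record sab := SAb {
  sab_ab :> nat -> zmodType;
  sab_act : forall m n, dmap m n -> sab_ab n -> sab_ab m;
  sab_actB : forall m n (t : dmap m n), zmod_morphism (sab_act t);
  sab_act_id : forall n x, sab_act (did n) x = x;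
  sab_act_comp : forall m n p (g : dmap n p) (f : dmap m n) x,
    sab_act (dcomp g f) x = sab_act f (sab_act g x) }.

Record shom (A B : sab) := SHom {
  shom_fun :> forall n, A n -> B n;
  shomB : forall n, zmod_morphism (@shom_fun n);
  shom_nat : forall m n (t : dmap m n) x,
    shom_fun (sab_act t x) = sab_act t (shom_fun x) }.
Arguments shom_fun {A B} _ n _.

Lemma shom_ext A B (f g : shom A B) : (forall n (x : A n), f n x = g n x) -> f = g.
Proof.
case: f => f fB fP; case: g => g gB gP /= fg.
have e : f = g by apply: functional_extensionality_dep => n; apply: funext => x.
case: _ / e gB gP {fg} => gB gP.
by rewrite (Prop_irrelevance fP gP) (Prop_irrelevance fB gB).
Qed.

Definition shom_id A : shom A A :=
  @SHom A A (fun n x => x) (fun _ _ _ => erefl) (fun _ _ _ _ => erefl).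

Lemma shom_comp_subproof A B C (g : shom B C) (f : shom A B) m n (t : dmap m n) x :
  g m (f m (sab_act t x)) = sab_act t (g n (f n x)).
Proof. by rewrite !shom_nat. Qed.

Definition shom_comp A B C (g : shom B C) (f : shom A B) : shom A C :=
  @SHom A C (fun n => g n \o f n)
    (fun n => zmod_morphism_comp (@shomB _ _ g n) (@shomB _ _ f n))
    (shom_comp_subproof g f).

Lemma shom_compE A B C (g : shom B C) (f : shom A B) n x :
  shom_comp g f n x = g n (f n x).
Proof. by []. Qed.

Lemma shom_compA A B C D (h : shom C D) (g : shom B C) (f : shom A B) :
  shom_comp h (shom_comp g f) = shom_comp (shom_comp h g) f.
Proof. exact: shom_ext. Qed.

Lemma shom_comp1l A B (f : shom A B) : shom_comp (shom_id B) f = f.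
Proof. exact: shom_ext. Qed.

Lemma shom_comp1r A B (f : shom A B) : shom_comp f (shom_id A) = f.
Proof. exact: shom_ext. Qed.

Definition U_sset (A : sab) : sset :=
  @SSet (fun n => A n) (@sab_act A) (@sab_act_id A) (@sab_act_comp A).

Lemma sab_act0 (A : sab) m n (t : dmap m n) : sab_act t 0%R = 0%R :> A m.
Proof. exact: (zmod_morphism0 (@sab_actB A m n t)). Qed.

Definition U (A : sab) : psset := @PSSet (U_sset A) (fun n => 0%R) (sab_act0 A).

Lemma shom0 A B (f : shom A B) n : f n 0%R = 0%R.
Proof. exact: (zmod_morphism0 (@shomB A B f n)). Qed.

Definition U_map A B (f : shom A B) : psmap (U A) (U B) :=
  @PSMap (U A) (U B) (@SMap (U_sset A) (U_sset B) f (@shom_nat A B f)) (shom0 f).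

Section Ztilde.
Variable X : psset.

Definition Zt_ab (n : nat) : zmodType := zred (bpt X n).

Definition Zt_act m n (t : dmap m n) : Zt_ab n -> Zt_ab m :=
  zrlift (fun x => zcl (bpt X m) (sact t x)).

Lemma Zt_act_pt m n (t : dmap m n) : zcl (bpt X m) (sact t (bpt X n)) = 0%R.
Proof. by rewrite bpt_act zcl_pt. Qed.

Lemma Zt_actE m n (t : dmap m n) x :
  Zt_act t (zcl (bpt X n) x) = zcl (bpt X m) (sact t x).
Proof. exact/zrliftE/Zt_act_pt. Qed.

Lemma Zt_actB m n (t : dmap m n) : zmod_morphism (Zt_act t).
Proof. exact/zrlift_zmod/Zt_act_pt. Qed.

Lemma Zt_act_id n x : Zt_act (did n) x = x.
Proof.
move: x; apply: zred_ext => //; first exact: Zt_actB.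
by move=> x; rewrite Zt_actE sact_id.
Qed.

Lemma Zt_act_comp m n p (g : dmap n p) (f : dmap m n) x :
  Zt_act (dcomp g f) x = Zt_act f (Zt_act g x).
Proof.
move: x; apply: zred_ext; first exact: Zt_actB.
  by apply: zmod_morphism_comp; apply: Zt_actB.
by move=> x; rewrite !Zt_actE sact_comp.
Qed.

(* Z~X = Z(X) / Z(pt) *)
Definition Zt : sab := SAb Zt_actB Zt_act_id Zt_act_comp.

Lemma eta_nat m n (t : dmap m n) (x : X n) :
  zcl (bpt X m) (sact t x) = sab_act (s := Zt) t (zcl (bpt X n) x).
Proof. by rewrite /= Zt_actE. Qed.

Definition eta : psmap X (U Zt) :=
  @PSMap X (U Zt) (@SMap X (U Zt) (fun n => zcl (bpt X n)) eta_nat)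
    (fun n => zcl_pt (bpt X n)).

End Ztilde.

Section ZtildeMap.
Variables (X Y : psset) (f : psmap X Y).

Definition Zt_map_fun n : Zt X n -> Zt Y n := zrlift (fun x => zcl (bpt Y n) (f n x)).

Lemma Zt_map_pt n : zcl (bpt Y n) (f n (bpt X n)) = 0%R.
Proof. by rewrite psmap_pt zcl_pt. Qed.

Lemma Zt_map_funE n x : Zt_map_fun (zcl (bpt X n) x) = zcl (bpt Y n) (f n x).
Proof. exact/zrliftE/Zt_map_pt. Qed.

Lemma Zt_mapB n : zmod_morphism (@Zt_map_fun n).
Proof. exact/zrlift_zmod/Zt_map_pt. Qed.

Lemma Zt_map_nat m n (t : dmap m n) x :
  Zt_map_fun (sab_act t x) = sab_act t (Zt_map_fun x).
Proof.
move: x; apply: zred_ext.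
- exact: (zmod_morphism_comp (@Zt_mapB m) (@sab_actB (Zt X) _ _ t)).
- exact: (zmod_morphism_comp (@sab_actB (Zt Y) _ _ t) (@Zt_mapB n)).
by move=> x; rewrite /= Zt_actE !Zt_map_funE Zt_actE smap_nat.
Qed.

Definition Zt_map : shom (Zt X) (Zt Y) := SHom Zt_mapB Zt_map_nat.

End ZtildeMap.

Lemma Zt_ext X B (f g : shom (Zt X) B) :
  (forall n (x : X n), f n (zcl (bpt X n) x) = g n (zcl (bpt X n) x)) -> f = g.
Proof.
move=> fg; apply: shom_ext => n.
exact: (zred_ext (@shomB _ _ f n) (@shomB _ _ g n) (fg n)).
Qed.

Section Counit.
Variable A : sab.

Definition counit_fun n : Zt (U A) n -> A n := zrlift (fun x : A n => x).

Lemma counit_funE n x : counit_fun (zcl (bpt (U A) n) x) = x.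
Proof. exact: zrliftE. Qed.

Lemma counit_funB n : zmod_morphism (@counit_fun n).
Proof. exact: zrlift_zmod. Qed.

Lemma counit_nat m n (t : dmap m n) x :
  counit_fun (sab_act t x) = sab_act t (counit_fun x).
Proof.
move: x; apply: zred_ext.
- exact: (zmod_morphism_comp (@counit_funB m) (@sab_actB (Zt (U A)) _ _ t)).
- exact: (zmod_morphism_comp (@sab_actB A _ _ t) (@counit_funB n)).
by move=> x; rewrite /= Zt_actE !counit_funE.
Qed.

Definition counit : shom (Zt (U A)) A := SHom counit_funB counit_nat.

End Counit.

Definition K (A : sab) : sab := Zt (U A).

Definition K_map A B (f : shom A B) : shom (K A) (K B) := Zt_map (U_map f).

Definition comult (A : sab) : shom (K A) (K (K A)) := Zt_map (eta (U A)).

Definition K_cl (A : sab) n (x : A n) : K A n := zcl (bpt (U A) n) x.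

Lemma K_mapE A B (f : shom A B) n (x : A n) : K_map f n (K_cl x) = K_cl (f n x).
Proof. exact: Zt_map_funE. Qed.

Lemma comultE (A : sab) n (x : A n) : comult A n (K_cl x) = K_cl (K_cl x).
Proof. exact: Zt_map_funE. Qed.

Lemma K_cl_act (A : sab) m n (t : dmap m n) (x : A n) :
  sab_act t (K_cl x) = K_cl (sab_act t x).
Proof. exact: Zt_actE. Qed.

Lemma K_ext A B (f g : shom (K A) B) :
  (forall n (x : A n), f n (K_cl x) = g n (K_cl x)) -> f = g.
Proof.
move=> fg; apply: shom_ext => n.
exact: (zred_ext (@shomB _ _ f n) (@shomB _ _ g n) (fg n)).
Qed.

Lemma K_map_comp A B C (g : shom B C) (f : shom A B) :
  K_map (shom_comp g f) = shom_comp (K_map g) (K_map f).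
Proof. by apply: K_ext => n x; rewrite shom_compE !K_mapE. Qed.

Lemma comult_nat A B (f : shom A B) :
  shom_comp (comult B) (K_map f) = shom_comp (K_map (K_map f)) (comult A).
Proof. by apply: K_ext => n x; rewrite !shom_compE !(K_mapE, comultE). Qed.

(* Every simplicial abelian group is a Kan complex, so the weak equivalences
   are the maps inducing isomorphisms on homotopy groups. *)
Definition weak_equiv A B (f : shom A B) : Prop := pi_iso (U_map f).

Definition fibration A B (f : shom A B) : Prop := kan_fibration (U_map f).

(* The left lifting property of 0 -> A against the trivial fibrations. *)
Definition cofibrant (A : sab) : Prop :=
  forall (E B : sab) (p : shom E B), fibration p -> weak_equiv p ->
  forall g : shom A B, exists h : shom A E, shom_comp p h = g.

Section FreeSab.
Variable X : sset.

Definition Zf_act m n (t : dmap m n) : zab (X n) -> zab (X m) :=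
  zlift (fun x => zgen (sact t x)).

Lemma Zf_actE m n (t : dmap m n) x : Zf_act t (zgen x) = zgen (sact t x).
Proof. exact: zliftE. Qed.

Lemma Zf_actB m n (t : dmap m n) : zmod_morphism (Zf_act t).
Proof. exact: zlift_zmod. Qed.

Lemma Zf_act_id n x : Zf_act (did n) x = x.
Proof.
move: x; apply: zab_ext => //; first exact: Zf_actB.
by move=> x; rewrite Zf_actE sact_id.
Qed.

Lemma Zf_act_comp m n p (g : dmap n p) (f : dmap m n) x :
  Zf_act (dcomp g f) x = Zf_act f (Zf_act g x).
Proof.
move: x; apply: zab_ext; first exact: Zf_actB.
  by apply: zmod_morphism_comp; apply: Zf_actB.
by move=> x; rewrite !Zf_actE sact_comp.
Qed.

(* The unreduced free simplicial abelian group ZX. *)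
Definition Zf : sab := SAb Zf_actB Zf_act_id Zf_act_comp.

End FreeSab.

Section FreeSabMap.
Variables (X Y : sset) (f : smap X Y).

Definition Zf_map_fun n : Zf X n -> Zf Y n := zlift (fun x => zgen (f n x)).

Lemma Zf_mapB n : zmod_morphism (@Zf_map_fun n).
Proof. exact: zlift_zmod. Qed.

Lemma Zf_map_nat m n (t : dmap m n) x :
  Zf_map_fun (sab_act t x) = sab_act t (Zf_map_fun x).
Proof.
move: x; apply: zab_ext.
- exact: (zmod_morphism_comp (@Zf_mapB m) (@sab_actB (Zf X) _ _ t)).
- exact: (zmod_morphism_comp (@sab_actB (Zf Y) _ _ t) (@Zf_mapB n)).
by move=> x; rewrite /= /Zf_map_fun Zf_actE !zliftE Zf_actE smap_nat.
Qed.

Definition Zf_map : shom (Zf X) (Zf Y) := SHom Zf_mapB Zf_map_nat.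

Lemma Zf_mapE n (x : X n) : Zf_map n (zgen x) = zgen (f n x).
Proof. exact: zliftE. Qed.

End FreeSabMap.

Section TensorSab.
Variables A B : sab.

Definition stens_act m n (t : dmap m n) : tens (A n) (B n) -> tens (A m) (B m) :=
  tlift (fun a b => tmk (sab_act t a) (sab_act t b)).

Lemma stens_actl m n (t : dmap m n) (b : B n) :
  zmod_morphism (fun a : A n => tmk (sab_act t a) (sab_act t b)).
Proof. exact: (zmod_morphism_comp (tmkBl _) (@sab_actB A m n t)). Qed.

Lemma stens_actr m n (t : dmap m n) (a : A n) :
  zmod_morphism (fun b : B n => tmk (sab_act t a) (sab_act t b)).
Proof. exact: (zmod_morphism_comp (tmkBr _) (@sab_actB B m n t)). Qed.

Lemma stens_actE m n (t : dmap m n) (a : A n) (b : B n) :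
  stens_act t (tmk a b) = tmk (sab_act t a) (sab_act t b).
Proof. by apply: tliftE; [apply: stens_actl|apply: stens_actr]. Qed.

Lemma stens_actB m n (t : dmap m n) : zmod_morphism (stens_act t).
Proof. by apply: tlift_zmod; [apply: stens_actl|apply: stens_actr]. Qed.

Lemma stens_act_id n x : stens_act (did n) x = x.
Proof.
move: x; apply: tens_ext => //; first exact: stens_actB.
by move=> a b; rewrite stens_actE !sab_act_id.
Qed.

Lemma stens_act_comp m n p (g : dmap n p) (f : dmap m n) x :
  stens_act (dcomp g f) x = stens_act f (stens_act g x).
Proof.
move: x; apply: tens_ext; first exact: stens_actB.
  by apply: zmod_morphism_comp; apply: stens_actB.
by move=> a b; rewrite !stens_actE !sab_act_comp.
Qed.

Definition stens : sab := SAb stens_actB stens_act_id stens_act_comp.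

End TensorSab.

Section TensorMap.
Variables (A A' B B' : sab) (f : shom A A') (g : shom B B').

Definition stens_map_fun n : stens A B n -> stens A' B' n :=
  tlift (fun a b => tmk (f n a) (g n b)).

Lemma stens_mapl n (b : B n) : zmod_morphism (fun a : A n => tmk (f n a) (g n b)).
Proof. exact: (zmod_morphism_comp (tmkBl _) (@shomB _ _ f n)). Qed.

Lemma stens_mapr n (a : A n) : zmod_morphism (fun b : B n => tmk (f n a) (g n b)).
Proof. exact: (zmod_morphism_comp (tmkBr _) (@shomB _ _ g n)). Qed.

Lemma stens_map_funE n (a : A n) (b : B n) : stens_map_fun (tmk a b) = tmk (f n a) (g n b).
Proof. by apply: tliftE; [apply: stens_mapl|apply: stens_mapr]. Qed.

Lemma stens_mapB n : zmod_morphism (@stens_map_fun n).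
Proof. by apply: tlift_zmod; [apply: stens_mapl|apply: stens_mapr]. Qed.

Lemma stens_map_nat m n (t : dmap m n) x :
  stens_map_fun (sab_act t x) = sab_act t (stens_map_fun x).
Proof.
move: x; apply: tens_ext.
- exact: (zmod_morphism_comp (@stens_mapB m) (@sab_actB (stens A B) _ _ t)).
- exact: (zmod_morphism_comp (@sab_actB (stens A' B') _ _ t) (@stens_mapB n)).
by move=> a b; rewrite /= stens_actE !stens_map_funE stens_actE !shom_nat.
Qed.

Definition stens_map : shom (stens A B) (stens A' B') := SHom stens_mapB stens_map_nat.

Lemma stens_mapE n (a : A n) (b : B n) : stens_map n (tmk a b) = tmk (f n a) (g n b).
Proof. exact: stens_map_funE. Qed.

End TensorMap.

Definition Tsimp (A : sab) (k : nat) : sab := stens A (Zf (simp k)).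

(* The element a (x) s of A (x) Z Delta[k]. *)
Definition tsimp (A : sab) k n (a : A n) (s : dmap n k) : Tsimp A k n :=
  tmk a (zgen s : Zf (simp k) n).

Lemma tsimp_act (A : sab) k m n (t : dmap m n) (a : A n) (s : dmap n k) :
  sab_act t (tsimp a s) = tsimp (sab_act t a) (dcomp s t).
Proof. by rewrite /tsimp [LHS]stens_actE; congr tmk; apply: Zf_actE. Qed.

Lemma Tsimp_ext A k B (f g : shom (Tsimp A k) B) :
  (forall n (a : A n) (s : dmap n k), f n (tsimp a s) = g n (tsimp a s)) -> f = g.
Proof.
move=> fg; apply: shom_ext => n.
exact: (tens_zab_ext (@shomB _ _ f n) (@shomB _ _ g n) (fg n)).
Qed.

Definition Tsimp_map A B k l (f : shom A B) (t : dmap k l) : shom (Tsimp A k) (Tsimp B l) :=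
  stens_map f (Zf_map (simp_map t)).

Lemma Tsimp_mapE A B k l (f : shom A B) (t : dmap k l) n (a : A n) (s : dmap n k) :
  Tsimp_map f t n (tsimp a s) = tsimp (f n a) (dcomp t s).
Proof. by rewrite stens_mapE Zf_mapE. Qed.

Lemma Tsimp_map_comp A B C k l p (g : shom B C) (f : shom A B)
    (u : dmap l p) (t : dmap k l) :
  shom_comp (Tsimp_map g u) (Tsimp_map f t) = Tsimp_map (shom_comp g f) (dcomp u t).
Proof. by apply: Tsimp_ext => n a s; rewrite shom_compE !Tsimp_mapE dcompA. Qed.

Section MappingSpace.
Variables A B : sab.

Definition Hom_act k l (t : dmap k l) (f : shom (Tsimp A l) B) : shom (Tsimp A k) B :=
  shom_comp f (Tsimp_map (shom_id A) t).

Lemma Hom_act_id k f : Hom_act (did k) f = f.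
Proof. by apply: Tsimp_ext => n a s; rewrite shom_compE Tsimp_mapE dcomp1l. Qed.

Lemma Hom_act_comp k l m (g : dmap l m) (f : dmap k l) h :
  Hom_act (dcomp g f) h = Hom_act f (Hom_act g h).
Proof. by apply: Tsimp_ext => n a s; rewrite !shom_compE !Tsimp_mapE dcompA. Qed.

Definition Hom : sset :=
  @SSet (fun k => shom (Tsimp A k) B) Hom_act Hom_act_id Hom_act_comp.

End MappingSpace.

Lemma Hom_post_nat A B C (g : shom B C) k l (t : dmap k l) (f : Hom A B l) :
  shom_comp g (sact t f) = sact (s := Hom A C) t (shom_comp g f).
Proof. exact: shom_compA. Qed.

Definition Hom_post A B C (g : shom B C) : smap (Hom A B) (Hom A C) :=
  @SMap (Hom A B) (Hom A C) (fun k f => shom_comp g f) (Hom_post_nat g).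

Section Strength.
Variables (A : sab) (k : nat).

Definition strength_gen n (s : dmap n k) : K A n -> K (Tsimp A k) n :=
  zrlift (fun a : A n => K_cl (tsimp a s)).

Lemma strength_pt n (s : dmap n k) : K_cl (tsimp (0%R : A n) s) = 0%R.
Proof. by rewrite /tsimp (zmod_morphism0 (tmkBl _)) /K_cl zcl_pt. Qed.

Lemma strength_genE n (s : dmap n k) (a : A n) :
  strength_gen s (K_cl a) = K_cl (tsimp a s).
Proof. by apply: zrliftE; apply: strength_pt. Qed.

Lemma strength_genB n (s : dmap n k) : zmod_morphism (strength_gen s).
Proof. by apply: zrlift_zmod; apply: strength_pt. Qed.

Definition strength_fun n : Tsimp (K A) k n -> K (Tsimp A k) n :=
  tlift (fun x : K A n => zlift (fun s : dmap n k => strength_gen s x)).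

Lemma strength_l n z :
  zmod_morphism (fun x : K A n => zlift (fun s : dmap n k => strength_gen s x) z).
Proof.
move=> x y; move: z; apply: zab_ext; first exact: zlift_zmod.
  by move=> u v; rewrite !zlift_zmod !opprD addrACA.
by move=> s; rewrite !zliftE strength_genB.
Qed.

Lemma strength_funE n (a : A n) (s : dmap n k) :
  strength_fun (tsimp (K_cl a) s) = K_cl (tsimp a s).
Proof.
rewrite /strength_fun /tsimp tliftE ?zliftE ?strength_genE //.
  exact: strength_l.
by move=> x; apply: zlift_zmod.
Qed.

Lemma strengthB n : zmod_morphism (@strength_fun n).
Proof.
apply: tlift_zmod; first exact: strength_l.
by move=> x; apply: zlift_zmod.
Qed.

Lemma strength_nat m n (t : dmap m n) x :
  strength_fun (sab_act t x) = sab_act t (strength_fun x).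
Proof.
move: x; apply: tens_zred_zab_ext.
- exact: (zmod_morphism_comp (@strengthB m) (@sab_actB (Tsimp (K A) k) _ _ t)).
- exact: (zmod_morphism_comp (@sab_actB (K (Tsimp A k)) _ _ t) (@strengthB n)).
move=> a s; rewrite -/(K_cl a) -/(tsimp (K_cl a) s) tsimp_act K_cl_act.
by rewrite !strength_funE K_cl_act tsimp_act.
Qed.

(* The natural map KA (x) Z Delta[k] -> K(A (x) Z Delta[k]), which sends the
   class of a tensored with s to the class of a (x) s. *)
Definition strength : shom (Tsimp (K A) k) (K (Tsimp A k)) := SHom strengthB strength_nat.

Lemma strengthE n (a : A n) (s : dmap n k) :
  strength n (tsimp (K_cl a) s) = K_cl (tsimp a s).
Proof. exact: strength_funE. Qed.

End Strength.

Lemma TsimpK_ext A k B (f g : shom (Tsimp (K A) k) B) :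
  (forall n (a : A n) (s : dmap n k),
     f n (tsimp (K_cl a) s) = g n (tsimp (K_cl a) s)) -> f = g.
Proof.
move=> fg; apply: shom_ext => n.
exact: (tens_zred_zab_ext (@shomB _ _ f n) (@shomB _ _ g n) (fg n)).
Qed.

Lemma strength_natural A B k (g : shom A B) :
  shom_comp (K_map (Tsimp_map g (did k))) (strength A k) =
  shom_comp (strength B k) (Tsimp_map (K_map g) (did k)).
Proof.
apply: TsimpK_ext => n a s.
by rewrite !shom_compE strengthE !(K_mapE, Tsimp_mapE) strengthE.
Qed.

Lemma strength_comult A k :
  shom_comp (comult (Tsimp A k)) (strength A k) =
  shom_comp (K_map (strength A k))
    (shom_comp (strength (K A) k) (Tsimp_map (comult A) (did k))).
Proof.
apply: TsimpK_ext => n a s.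
by rewrite !shom_compE !(strengthE, comultE, Tsimp_mapE) K_mapE strengthE dcomp1l.
Qed.

(* The action of K on k-simplices of mapping spaces. *)
Definition K_simp A B k (f : Hom A B k) : Hom (K A) (K B) k :=
  shom_comp (K_map f) (strength A k).

Lemma K_simp_nat A B k l (t : dmap k l) (f : Hom A B l) :
  K_simp (sact t f) = sact (s := Hom (K A) (K B)) t (K_simp f).
Proof.
apply: TsimpK_ext => n a s; rewrite !shom_compE Tsimp_mapE !strengthE !K_mapE.
by rewrite shom_compE Tsimp_mapE.
Qed.

Record coalg := Coalg {
  coalg_sab :> sab;
  coact : shom coalg_sab (K coalg_sab);
  coact_assoc :
    shom_comp (K_map coact) coact = shom_comp (comult coalg_sab) coact;
  coact_counit : shom_comp (counit coalg_sab) coact = shom_id coalg_sab }.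

Section Chains.
Variable X : psset.

Definition chains_coact : shom (Zt X) (K (Zt X)) := Zt_map (eta X).

Lemma chains_coactE n (x : X n) :
  chains_coact n (zcl (bpt X n) x) = @K_cl (Zt X) n (zcl (bpt X n) x).
Proof. exact: Zt_map_funE. Qed.

Lemma chains_assoc :
  shom_comp (K_map chains_coact) chains_coact = shom_comp (comult (Zt X)) chains_coact.
Proof.
apply: Zt_ext => n x.
by rewrite !shom_compE !chains_coactE K_mapE comultE chains_coactE.
Qed.

Lemma chains_counit : shom_comp (counit (Zt X)) chains_coact = shom_id (Zt X).
Proof.
apply: Zt_ext => n x.
by rewrite shom_compE chains_coactE; apply: counit_funE.
Qed.

Definition chains : coalg := Coalg chains_assoc chains_counit.

End Chains.

(* Diagrams of simplicial sets indexed by Delta_res, presented by the cofaces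
   and the relations d^j d^i = d^i d^(j-1) for i < j. *)
Record rcosset := RCoSSet {
  rc_obj :> nat -> sset;
  rc_coface : forall n, 'I_n.+2 -> smap (rc_obj n) (rc_obj n.+1);
  rc_cofaceP : forall n (i j : 'I_n.+2), i <= j ->
    smap_comp (rc_coface (lift ord0 j)) (rc_coface i) =
    smap_comp (rc_coface (widen_ord (leqnSn n.+2) i)) (rc_coface j) }.

Record rcomap (A B : rcosset) := RCoMap {
  rcomap_fun :> forall n, smap (A n) (B n);
  rcomap_coface : forall n (i : 'I_n.+2),
    smap_comp (rcomap_fun n.+1) (rc_coface A i) =
    smap_comp (rc_coface B i) (rcomap_fun n) }.

Lemma simp_cofaceP n (i j : 'I_n.+2) : i <= j ->
  smap_comp (simp_map (dcoface (lift ord0 j))) (simp_map (dcoface i)) =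
  smap_comp (simp_map (dcoface (widen_ord (leqnSn n.+2) i))) (simp_map (dcoface j)).
Proof.
move=> ij; apply: smap_ext => m s /=; rewrite !dcompA; congr (dcomp _ s).
apply: dmap_ext => k; rewrite !dcompE !dcofaceE; apply: val_inj => /=.
rewrite [bump 0 j]/bump leq0n add1n bumpC.
have -> : bump j.+1 i = i by rewrite /bump ltnNge ij.
by have -> : unbump i j.+1 = j by rewrite /unbump ltnS ij subn1.
Qed.

Definition Delta_rc : rcosset :=
  @RCoSSet simp (fun n i => simp_map (dcoface i)) simp_cofaceP.

Definition Kn (n : nat) (A : sab) : sab := iter n K A.

Section Cobar.
Variables Y Y' : coalg.

(* For i < n, K^i(comult) with the comultiplication applied to the (i+1)-st
   copy of K; for i = n, K^n(coact). *)
Fixpoint Kn_coface n i : shom (Kn n Y') (Kn n.+1 Y') :=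
  match n, i with
  | 0, _ => coact Y'
  | n'.+1, 0 => comult (Kn n' Y')
  | n'.+1, i'.+1 => K_map (Kn_coface n' i')
  end.

Lemma Kn_cofaceP n i j : i <= j <= n ->
  shom_comp (Kn_coface n.+1 j.+1) (Kn_coface n i) =
  shom_comp (Kn_coface n.+1 i) (Kn_coface n j).
Proof.
elim: n i j => [|n IHn] [|i] [|j] //=.
- by move=> _; apply: coact_assoc.
- by move=> _; apply: K_ext => n' x; rewrite !shom_compE !(K_mapE, comultE).
- by move=> _; rewrite comult_nat.
- by move=> ij; rewrite -!K_map_comp; congr K_map; apply: IHn.
Qed.

Definition cobar_d0_fun n k (f : Hom Y (Kn n Y') k) : Hom Y (Kn n.+1 Y') k :=
  shom_comp (K_simp f) (Tsimp_map (coact Y) (did k)).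

Lemma cobar_d0_nat n k l (t : dmap k l) (f : Hom Y (Kn n Y') l) :
  cobar_d0_fun (sact t f) = sact (s := Hom Y (Kn n.+1 Y')) t (cobar_d0_fun f).
Proof.
rewrite /cobar_d0_fun K_simp_nat.
apply: Tsimp_ext => m a s; rewrite !shom_compE !Tsimp_mapE.
by rewrite !dcomp1l.
Qed.

Definition cobar_d0 n : smap (Hom Y (Kn n Y')) (Hom Y (Kn n.+1 Y')) :=
  SMap (@cobar_d0_nat n).

(* d^0 f = (K f) o m_Y; for i > 0, d^i is induced by the comultiplication on the
   i-th copy of K, or by the coaction of Y' when i = n + 1. *)
Definition cobar_coface n (i : 'I_n.+2) : smap (Hom Y (Kn n Y')) (Hom Y (Kn n.+1 Y')) :=
  if i == 0 :> nat then cobar_d0 n else Hom_post Y (Kn_coface n i.-1).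

Lemma cobar_d0_post n (g : shom (Kn n Y') (Kn n.+1 Y')) :
  smap_comp (Hom_post Y (K_map g)) (cobar_d0 n) =
  smap_comp (cobar_d0 n.+1) (Hom_post Y g).
Proof.
apply: smap_ext => k f /=; rewrite /cobar_d0_fun /K_simp.
by rewrite K_map_comp !shom_compA.
Qed.

Lemma cobar_d0_d0 n :
  smap_comp (Hom_post Y (comult (Kn n Y'))) (cobar_d0 n) =
  smap_comp (cobar_d0 n.+1) (cobar_d0 n).
Proof.
apply: smap_ext => k f /=; rewrite /cobar_d0_fun /K_simp !K_map_comp.
rewrite shom_compA shom_compA comult_nat -(shom_compA _ (comult _)) strength_comult.
rewrite -!shom_compA Tsimp_map_comp -coact_assoc dcomp1l.
congr shom_comp; congr shom_comp.
by rewrite [RHS]shom_compA strength_natural -shom_compA Tsimp_map_comp dcomp1l.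
Qed.

Lemma cobar_cofaceP n (i j : 'I_n.+2) : i <= j ->
  smap_comp (cobar_coface (lift ord0 j)) (cobar_coface i) =
  smap_comp (cobar_coface (widen_ord (leqnSn n.+2) i)) (cobar_coface j).
Proof.
case: i j => [[|i] hi] [[|j] hj] //= ij; rewrite /cobar_coface /= ?bumpS /=.
- by rewrite cobar_d0_d0.
- by rewrite cobar_d0_post.
- apply: smap_ext => k f /=; rewrite !shom_compA; congr shom_comp.
  by apply: Kn_cofaceP; rewrite -ltnS ij.
Qed.

Definition cobar : rcosset :=
  @RCoSSet (fun n => Hom Y (Kn n Y')) cobar_coface cobar_cofaceP.

Definition derived_map : Type := rcomap Delta_rc cobar.

Lemma tsimp_unit_nat m n (t : dmap m n) (y : Y n) :
  tsimp (sab_act t y) (dconst m) = sab_act t (tsimp y (dconst n)).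
Proof. by rewrite tsimp_act; congr tsimp; apply: dmap_to0. Qed.

(* The isomorphism Y = Y (x) Z Delta[0]. *)
Definition tsimp_unit : shom Y (Tsimp Y 0) :=
  @SHom Y (Tsimp Y 0) (fun n y => tsimp y (dconst n)) (fun n => tmkBl _) tsimp_unit_nat.

Definition underlying (f : derived_map) : shom Y Y' :=
  shom_comp (f 0 0 (did 0) : Hom Y Y' 0) tsimp_unit.

End Cobar.

Definition derived_weak_equiv (Y Y' : coalg) (f : derived_map Y Y') : Prop :=
  weak_equiv (underlying f).

Definition derived_step (Y Y' : coalg) : Prop :=
  [/\ cofibrant Y, cofibrant Y' & exists f : derived_map Y Y', derived_weak_equiv f].

Definition derived_equivalent : coalg -> coalg -> Prop :=
  clos_refl_sym_trans coalg derived_step.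

(* Main.v *)
From HB Require Import structures.
From mathcomp Require Import freeg.
From mathcomp Require Import all_boot all_algebra boolp zify.
From Stdlib Require Import Relation_Operators.
Require Import Defs.

(** The comonad acts dimension by dimension, and in each dimension the free
    abelian group functor on pointed sets is comonadic. Hence a coalgebra [Y] is
    isomorphic, through a strict coalgebra map, to the chains on the pointed
    space [X] of its grouplike elements, those [y] whose coaction is the class
    of [y] ([grouplike_incl_weak_equiv]; the point is [other_part_coact]). A
    strict coalgebra map gives a derived one whose simplices are all constant
    ([strict_derived]), so every equivalence needed below is induced by a strict
    map. The chains on any pointed space are cofibrant ([cofibrant_Zt]).

    A simplicial abelian group is 1-connected iff its groups [H_0] and [H_1]
    vanish ([one_connected_sab]). Weak equivalences preserve these groups, and
    both vanish for the chains on a 1-connected space ([one_connected_Zt]); this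
    proves that 1-connectedness of [Y] is necessary.

    Conversely, if [Y] is 1-connected then [H_0] and [H_1] of [X] vanish, but the
    fundamental group of [X] may be a nontrivial perfect group, so [X] has to be
    replaced by a 1-connected space [X'] with a homology equivalence [X -> X']
    ([homology_one_connected]). This plus construction starts from the quotient
    of [X] by its 1-skeleton, which is 1-connected but has lost the normalized
    chains [C_1 -> C_0]. They are put back two degrees higher: there is a new
    2-cell [[v]] for each vertex [v], and for each edge [e] a new 3-cell with
    boundary [c_e + [d_0 e] - [d_1 e]], where the 2-chain [c_e] has boundary
    [e - cone (bd e)] for a section [cone] of [bd : C_1 -> C_0]. The section and
    the chains [c_e] exist because [H_0 = 0] and [H_1 = 0]. The homology brought in
    by the new cells is that of [C_1 -> C_0] in degrees 3 and 2, the homology lost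
    in the quotient is that of [C_1 -> C_0] in degrees 1 and 0, and the connecting
    map takes a 1-cycle [b], seen in degree 3, to the boundary of [c_b], which is
    [b] itself. So the map [X -> X'] is a homology equivalence, and neither a basis
    of the 1-cycles nor a maximal tree has to be chosen.

    In a space with one vertex and without nondegenerate edges any list of
    2-simplices can be added up by 3-simplices: a 2-cell and a 3-cell are attached
    for each nonempty word in signed 2-simplices, and the 3-cell exhibits the 2-cell
    as the sum of the first letter and of the 2-cell of the remaining word. These
    two cells cancel, so the homology is unchanged, and the chain
    [c_e + [d_0 e] - [d_1 e]] becomes a single 2-simplex to which the 3-cell of [e]
    can be attached.

    Homotopy groups enter through normalized chains: a quasi-isomorphism of
    normalized chains is a weak equivalence ([quasi_iso_weak_equiv]). *)

Set Implicit Arguments.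
Unset Strict Implicit.
Unset Printing Implicit Defensive.

Import GRing.Theory.

(** * Cofaces and codegeneracies *)

Lemma cof_subproof n i (k : 'I_n.+1) : bump i k < n.+2.
Proof. by rewrite /bump; have := ltn_ord k; lia. Qed.

Lemma cof_mono n i (j k : 'I_n.+1) : j <= k ->
  Ordinal (cof_subproof i j) <= Ordinal (cof_subproof i k).
Proof. by rewrite /= leq_bump2. Qed.

Definition cof n (i : nat) : dmap n n.+1 := mk_dmap (@cof_mono n i).

Lemma cofE n i k : cof n i k = bump i k :> nat.
Proof. by rewrite mk_dmapE. Qed.

Lemma cod_subproof n i (k : 'I_n.+2) : minn n (unbump i k) < n.+1.
Proof. by lia. Qed.

Lemma cod_mono n i (j k : 'I_n.+2) : j <= k ->
  Ordinal (cod_subproof i j) <= Ordinal (cod_subproof i k).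
Proof. by rewrite /unbump /=; lia. Qed.

(** The minimum keeps the value in range for the indices [i > n]. *)
Definition cod n (i : nat) : dmap n.+1 n := mk_dmap (@cod_mono n i).

Lemma codE n i k : i <= n -> cod n i k = unbump i k :> nat.
Proof. by move=> hi; rewrite mk_dmapE /= /unbump; have := ltn_ord k; lia. Qed.

Lemma dmap_nat_ext m n (s t : dmap m n) : (forall k, s k = t k :> nat) -> s = t.
Proof. by move=> st; apply: dmap_ext => k; apply/val_inj/st. Qed.

Ltac dmap_compute := let k := fresh "k" in apply: dmap_nat_ext => k;
  rewrite ?dcompE ?didE ?(cofE, codE) ?(cofE, codE) /bump /unbump;
  generalize (ltn_ord k); lia.

Lemma cof_cof n i j : i <= j -> dcomp (cof n.+1 j.+1) (cof n i) = dcomp (cof n.+1 i) (cof n j).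
Proof. by move=> ij; dmap_compute. Qed.

Lemma cod_cof_id n i : i <= n -> dcomp (cod n i) (cof n i) = did n.
Proof. by move=> ij; dmap_compute. Qed.

Lemma cod_cofS_id n i : i <= n -> dcomp (cod n i) (cof n i.+1) = did n.
Proof. by move=> ij; dmap_compute. Qed.

Lemma cod_cof_lt n i j : i <= j <= n ->
  dcomp (cod n.+1 j.+1) (cof n.+1 i) = dcomp (cof n i) (cod n j).
Proof. by case/andP=> ij jn; dmap_compute. Qed.

Lemma cod_cof_gt n i j : j < i <= n.+1 ->
  dcomp (cod n.+1 j) (cof n.+1 i.+1) = dcomp (cof n i) (cod n j).
Proof. by case/andP=> ij jn; dmap_compute. Qed.

Lemma cod_cod n i j : i <= j <= n ->
  dcomp (cod n j) (cod n.+1 i) = dcomp (cod n i) (cod n.+1 j.+1).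
Proof. by case/andP=> ij jn; dmap_compute. Qed.

Lemma dcoface_cof n (i : 'I_n.+2) : dcoface i = cof n i.
Proof. by apply: dmap_nat_ext => k; rewrite dcofaceE cofE. Qed.

Lemma dmap_inj_id n (t : dmap n n) : injective t -> t = did n.
Proof.
move=> tI; have lt (i j : 'I_n.+1) : i < j -> t i < t j.
  move=> ij; rewrite ltn_neqAle dmapP ?(ltnW ij) // andbT.
  by apply: contraTneq ij => /val_inj/tI ->; rewrite ltnn.
have ge (k : nat) (hk : k < n.+1) : k <= t (Ordinal hk).
  elim: k hk => // k IH hk; have hk' := ltnW hk.
  by apply: leq_ltn_trans (IH hk') (lt _ _ _) => /=.
have le (k : nat) (hk : n - k < n.+1) : t (Ordinal hk) + k <= n + (k - n).
  elim: k hk => [|k IH] hk; first by have := ltn_ord (t (Ordinal hk)); lia.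
  have hk' : n - k < n.+1 by lia.
  have [kn|kn] := ltnP k n.
    by have /= := lt (Ordinal hk) (Ordinal hk'); have := IH hk'; lia.
  have -> : Ordinal hk = Ordinal hk' by apply: val_inj => /=; lia.
  by have := IH hk'; lia.
apply: dmap_nat_ext => k; rewrite didE.
have hk : n - (n - k) < n.+1 by lia.
have e : Ordinal hk = k by apply: val_inj => /=; have := ltn_ord k; lia.
have e' : Ordinal (ltn_ord k) = k by apply: val_inj.
by have := le _ hk; have := ge _ (ltn_ord k); rewrite e e'; have := ltn_ord k; lia.
Qed.

(** A monotone map that identifies two vertices identifies two adjacent ones. *)
Lemma dmap_factor_cod n m (t : dmap n.+1 m) : ~ injective t ->
  exists2 i, i <= n & t = dcomp (dcomp t (cof n i)) (cod n i).
Proof.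
move=> tI.
suff [i hi e] : exists2 i, i <= n & t (inord i) = t (inord i.+1).
  exists i => //; apply: dmap_ext => k; rewrite !dcompE.
  have [ki|ki] := eqVneq (val k) i.
    have -> : k = inord i by apply: val_inj; rewrite /= inordK //; lia.
    rewrite e; congr (t _); apply: val_inj.
    by rewrite /= !(cofE, codE) // !inordK /bump /unbump; lia.
  congr (t _); apply: val_inj.
  by rewrite /= !(cofE, codE) // /bump /unbump; move: (ltn_ord k) ki; rewrite /=; lia.
apply: contrapT => no; apply: tI.
have lt (i j : nat) : i < j <= n.+1 -> t (inord i) < t (inord j).
  move=> /andP[ij jn]; have ii : i <= n by lia.
  have [/val_inj e|ne] := eqVneq (val (t (inord i))) (val (t (inord i.+1))).
    by case: no; exists i.
  apply: (@leq_trans (t (inord i.+1))); last by apply: dmapP; rewrite !inordK; lia.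
  by rewrite ltn_neqAle ne dmapP // !inordK; lia.
move=> i j e; apply: val_inj => /=; apply: contra_eq (congr1 val e) => ne.
have [hi hj] := (ltn_ord i, ltn_ord j).
have := lt i j; have := lt j i; rewrite !inord_val /=; move: ne hi hj => /=; lia.
Qed.

Lemma dmap_factor_cof n m (t : dmap m n.+1) (i : 'I_n.+2) : (forall k, t k != i) ->
  t = dcomp (cof n i) (dcomp (cod n i) t).
Proof.
move=> ti; apply: dmap_nat_ext => k; rewrite !dcompE cofE.
have /eqP ne : t k != i :> nat by rewrite ti.
have [ik|ik] := leqP i n.
  by rewrite codE // /bump /unbump; lia.
rewrite mk_dmapE /= /bump /unbump; move: (ltn_ord (t k)) (ltn_ord i) ne ik; lia.
Qed.

Lemma dmap_pigeon n m (t : dmap n m) : m < n -> ~ injective t.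
Proof. by move=> mn /leq_card; rewrite !card_ord; lia. Qed.

Lemma dmap_missed m n (t : dmap m n) : (m < n)%N -> exists i, forall k, t k != i.
Proof.
move=> mn; have [/existsP[i /forallP ti]|ts] := boolP [exists i, [forall k, t k != i]].
  by exists i.
suff : (n.+1 <= m.+1)%N by lia.
rewrite -[n.+1]card_ord; apply: (@leq_trans #|codom t|); last first.
  by have := leq_image_card t predT; rewrite cardT size_enum_ord.
apply/subset_leq_card/subsetP => i _; move: ts; rewrite negb_exists => /forallP/(_ i).
by rewrite negb_forall => /existsP[j]; rewrite negbK => /eqP <-; apply: codom_f.
Qed.

Lemma cof_inj (n i j : nat) : (i <= n.+1)%N -> (j <= n.+1)%N -> cof n i = cof n j -> i = j.
Proof.
have lt k l : (k < l <= n.+1)%N -> cof n k <> cof n l.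
  move=> kl e; have hk : (k < n.+1)%N by lia.
  have := congr1 (fun t : dmap n n.+1 => val (t (Ordinal hk))) e.
  by rewrite /= !cofE /= /bump; lia.
move=> hi hj e; case: (ltngtP i j) => // ij.
  by case: (lt i j) => //; lia.
by case: (lt j i) => //; lia.
Qed.

Lemma cof_injective n i : injective (cof n i).
Proof.
by move=> j k /(congr1 val); rewrite /= !cofE => /(can_inj (bumpK i))/val_inj.
Qed.

Lemma dmap_inj_cof n (s : dmap n n.+1) : injective s -> exists j : 'I_n.+2, s = cof n j.
Proof.
move=> sI; have [j hj] := dmap_missed s (ltnSn n); exists j.
rewrite (dmap_factor_cof hj) (dmap_inj_id (t := dcomp (cod n j) s)) ?dcomp1r //.
move=> k l e; apply: sI; rewrite (dmap_factor_cof hj) !dcompE.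
by move: e; rewrite !dcompE => ->.
Qed.

(** Induction on [m + n]: a map that is not injective factors through a
    codegeneracy, one that misses a vertex factors through a coface, and a
    bijective one is an identity. *)
Lemma dmap_ind (Q : forall m n, dmap m n -> Prop) :
  (forall n, Q n n (did n)) ->
  (forall m n i (t : dmap m n), i <= n.+1 -> Q m n t -> Q m n.+1 (dcomp (cof n i) t)) ->
  (forall m n i (t : dmap m n), i <= m -> Q m n t -> Q m.+1 n (dcomp t (cod m i))) ->
  forall m n (t : dmap m n), Q m n t.
Proof.
move=> Qid Qcof Qcod m n; move: {2}(m + n) (leqnn (m + n)) => k.
elim: k m n => [|k IH] m n mnk t.
  have [em en] : m = 0 /\ n = 0 by lia.
  by move: t; rewrite em en => t; rewrite (dmap_to0 t (did 0)).
have [tI|tI] := pselect (injective t); last first.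
  case: m t mnk tI => [|m] t mnk tI.
    by case: tI => i j _; rewrite (ord1 i) (ord1 j).
  by have [i hi ->] := dmap_factor_cod tI; apply: Qcod => //; apply: IH; lia.
have [/existsP[i /forallP ti]|ts] := boolP [exists i, [forall k, t k != i]].
  case: n t mnk tI i ti => [|n] t mnk tI i ti.
    by have := ti ord0; rewrite (ord1 i) (ord1 (t ord0)).
  rewrite (dmap_factor_cof ti); apply: Qcof; first by have := ltn_ord i.
  by apply: IH; lia.
have cardn : n.+1 <= m.+1.
  rewrite -[n.+1]card_ord -[m.+1]card_ord -(card_codom tI).
  apply/subset_leq_card/subsetP => i _; move: ts; rewrite negb_exists => /forallP/(_ i).
  by rewrite negb_forall => /existsP[j]; rewrite negbK => /eqP <-; apply: codom_f.
have cardm : m.+1 <= n.+1 by have := leq_card t tI; rewrite !card_ord.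
have e : m = n by lia.
by move: t tI {ts mnk cardn cardm}; rewrite e => t /dmap_inj_id ->.
Qed.

Local Open Scope ring_scope.

(** * Induction on generators *)

Lemma zab_ind (T : Type) (Q : zab T -> Prop) :
  Q 0 -> (forall a b, Q a -> Q b -> Q (a - b)) -> (forall x, Q (zgen x)) ->
  forall a, Q a.
Proof.
move=> Q0 QB Qg a.
have QN b : Q b -> Q (- b) by move=> hb; rewrite -sub0r; apply: QB.
have QD b c : Q b -> Q c -> Q (b + c).
  by move=> hb hc; rewrite -[c]opprK; apply/QB/QN.
rewrite -[a]freeg_sumE; apply: big_ind => // x _.
have -> : << coeff x a *g x >> = zgen x *~ coeff x a :> zab T.
  by rewrite /zgen freegU_mulz intz.
have Qn n : Q (zgen x *+ n) by elim: n => [|n IH]; rewrite ?mulr0n ?mulrS //; apply: QD.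
by case: (coeff x a) => n; rewrite ?NegzE ?mulrNz -pmulrn; [apply: Qn|apply/QN/Qn].
Qed.

Lemma zred_ind (T : Type) (pt : T) (Q : zred pt -> Prop) :
  Q 0 -> (forall a b, Q a -> Q b -> Q (a - b)) -> (forall x, Q (zcl pt x)) ->
  forall a, Q a.
Proof.
move=> Q0 QB Qg; elim/gquot_ind; apply: zab_ind => [|a b ha hb|x]; last exact: Qg.
  by rewrite raddf0.
by rewrite raddfB; apply: QB.
Qed.

Lemma Zt_ind (X : psset) n (Q : Zt X n -> Prop) :
  Q 0 -> (forall a b, Q a -> Q b -> Q (a - b)) -> (forall x, Q (zcl (bpt X n) x)) ->
  forall a, Q a.
Proof. exact: zred_ind. Qed.

(** * Normalized chains *)

HB.instance Definition _ (A : sab) m n (t : dmap m n) :=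
  GRing.isZmodMorphism.Build (A n) (A m) (@sab_act A m n t) (@sab_actB A m n t).

HB.instance Definition _ (A B : sab) (f : shom A B) n :=
  GRing.isZmodMorphism.Build (A n) (B n) (f n) (@shomB A B f n).

Notation "''d_' i" := (sab_act (cof _ i)) (at level 8, i at level 2, format "''d_' i").
Notation "''s_' i" := (sab_act (cod _ i)) (at level 8, i at level 2, format "''s_' i").

Section SimplicialIdentities.
Variables (X : sset) (n : nat).

Lemma sact_dd i j (x : X n.+2) : (i <= j)%N ->
  sact (cof n i) (sact (cof n.+1 j.+1) x) = sact (cof n j) (sact (cof n.+1 i) x).
Proof. by move=> ij; rewrite -!sact_comp cof_cof. Qed.

Lemma sact_ds_id i (x : X n) : (i <= n)%N -> sact (cof n i) (sact (cod n i) x) = x.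
Proof. by move=> ij; rewrite -!sact_comp cod_cof_id ?sact_id. Qed.

Lemma sact_dSs_id i (x : X n) : (i <= n)%N -> sact (cof n i.+1) (sact (cod n i) x) = x.
Proof. by move=> ij; rewrite -!sact_comp cod_cofS_id ?sact_id. Qed.

Lemma sact_ds_lt i j (x : X n.+1) : (i <= j <= n)%N ->
  sact (cof n.+1 i) (sact (cod n.+1 j.+1) x) = sact (cod n j) (sact (cof n i) x).
Proof. by move=> ij; rewrite -!sact_comp cod_cof_lt. Qed.

Lemma sact_ds_gt i j (x : X n.+1) : (j < i <= n.+1)%N ->
  sact (cof n.+1 i.+1) (sact (cod n.+1 j) x) = sact (cod n j) (sact (cof n i) x).
Proof. by move=> ij; rewrite -!sact_comp cod_cof_gt. Qed.

Lemma sact_ss i j (x : X n) : (i <= j <= n)%N ->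
  sact (cod n.+1 i) (sact (cod n j) x) = sact (cod n.+1 j.+1) (sact (cod n i) x).
Proof. by move=> ij; rewrite -!sact_comp cod_cod. Qed.

End SimplicialIdentities.

Section AdditiveSimplicialIdentities.
Variables (A : sab) (n : nat).

Lemma act_dd i j (x : A n.+2) : (i <= j)%N -> 'd_i ('d_j.+1 x) = 'd_j ('d_i x).
Proof. exact: (@sact_dd (U A)). Qed.

Lemma act_ds_id i (x : A n) : (i <= n)%N -> 'd_i ('s_i x) = x.
Proof. exact: (@sact_ds_id (U A)). Qed.

Lemma act_dSs_id i (x : A n) : (i <= n)%N -> 'd_i.+1 ('s_i x) = x.
Proof. exact: (@sact_dSs_id (U A)). Qed.

Lemma act_ds_lt i j (x : A n.+1) : (i <= j <= n)%N -> 'd_i ('s_j.+1 x) = 's_j ('d_i x).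
Proof. exact: (@sact_ds_lt (U A)). Qed.

Lemma act_ds_gt i j (x : A n.+1) : (j < i <= n.+1)%N -> 'd_i.+1 ('s_j x) = 's_j ('d_i x).
Proof. exact: (@sact_ds_gt (U A)). Qed.

Lemma act_ss i j (x : A n) : (i <= j <= n)%N -> 's_i ('s_j x) = 's_j.+1 ('s_i x).
Proof. exact: (@sact_ss (U A)). Qed.

End AdditiveSimplicialIdentities.

Definition degenerate (A : sab) n (a : A n) : Prop :=
  exists m (t : dmap n m) (b : A m), (m < n)%N /\ a = sab_act t b.

Definition nch (A : sab) n : zmodType := gquot (@degenerate A n).

Definition cls (A : sab) n (a : A n) : nch A n := gpi _ a.

HB.instance Definition _ (A : sab) n :=
  GRing.isZmodMorphism.Build (A n) (nch A n) (@cls A n) (@gpi_zmod _ _).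

Lemma clsB (A : sab) n (a b : A n) : cls (a - b) = cls a - cls b.
Proof. exact: raddfB. Qed.

Definition bd (A : sab) n (a : A n.+1) : A n :=
  \sum_(i < n.+2) 'd_i a *~ (-1) ^+ i.

Lemma bdB (A : sab) n : zmod_morphism (@bd A n).
Proof.
by move=> a b; rewrite /bd -sumrB; apply: eq_bigr => i _; rewrite raddfB mulrzBl.
Qed.

HB.instance Definition _ (A : sab) n :=
  GRing.isZmodMorphism.Build (A n.+1) (A n) (@bd A n) (@bdB A n).

Lemma bdD (A : sab) n (a b : A n.+1) : bd (a + b) = bd a + bd b.
Proof. exact: raddfD. Qed.

Lemma bd1E (A : sab) (a : A 1%N) : bd a = 'd_0 a - 'd_1 a.
Proof. by rewrite /bd !big_ord_recl big_ord0 /= expr0 expr1 mulr1z mulrN1z addr0. Qed.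

Lemma bd2E (A : sab) (a : A 2) : bd a = 'd_0 a - 'd_1 a + 'd_2 a.
Proof.
rewrite /bd !big_ord_recl big_ord0 /= expr0 expr1 sqrrN expr1n !mulr1z mulrN1z.
by rewrite addr0 addrA.
Qed.

Lemma bd3E (C : sab) (c : C 3) : bd c = 'd_0 c - 'd_1 c + 'd_2 c - 'd_3 c.
Proof.
rewrite /bd !big_ord_recl big_ord0 /= expr0 expr1 sqrrN expr1n !mulr1z mulrN1z.
by rewrite exprS sqrrN expr1n mulr1 mulrN1z addr0 !addrA.
Qed.

Lemma shom_bd A B (f : shom A B) n (a : A n.+1) : f n (bd a) = bd (f n.+1 a).
Proof. by rewrite raddf_sum; apply: eq_bigr => i _; rewrite raddfMz /= shom_nat. Qed.

Section NormalizedChains.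
Variable A : sab.
Implicit Types n : nat.

Lemma cls_act m n (t : dmap n m) (b : A m) : (m < n)%N -> cls (sab_act t b) = 0.
Proof. by move=> mn; apply: gpi_eq0; exists m, t, b. Qed.

Lemma cls_act_noninj m n (t : dmap n m) (b : A m) : ~ injective t -> cls (sab_act t b) = 0.
Proof.
case: n t => [|n] t tI; first by case: tI => i j _; rewrite (ord1 i) (ord1 j).
by have [i hi ->] := dmap_factor_cod tI; rewrite sab_act_comp cls_act.
Qed.

Lemma degenerate_s n (a : A n.+1) : degenerate a ->
  exists i (b : A n), (i <= n)%N /\ a = 's_i b.
Proof.
case=> m [t [b [mn ->]]]; have [i hi e] := dmap_factor_cod (dmap_pigeon (t := t) mn).
by exists i, (sab_act (dcomp t (cof n i)) b); rewrite -sab_act_comp -e.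
Qed.

Lemma cls_eq0_hom n (M : zmodType) (f : A n -> M) (a : A n) : zmod_morphism f ->
  (forall b, degenerate b -> f b = 0) -> cls a = 0 -> f a = 0.
Proof.
move=> fB fD a0; rewrite -(gliftE fB fD a) -/(cls a) a0.
by rewrite (zmod_morphism0 (glift_zmod fB fD)).
Qed.

(** [s_j b] has two faces equal to [b], which cancel in the alternating sum. *)
Lemma cls_bd_s n j (b : A n) : (j <= n)%N -> cls (bd ('s_j b)) = 0.
Proof.
move=> jn; have hj : (j < n.+2)%N by lia.
have hj1 : (j.+1 < n.+2)%N by lia.
rewrite /bd (bigD1 (Ordinal hj)) //= (bigD1 (Ordinal hj1)) /=; last first.
  by rewrite -val_eqE /=; lia.
rewrite act_ds_id // act_dSs_id // addrA exprS mulN1r mulrNz subrr add0r raddf_sum big1 // => i.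
rewrite -!val_eqE /= => /andP[/eqP ij /eqP ij1]; rewrite raddfMz /=.
case: n b jn hj hj1 i ij ij1 => [|n] b jn hj hj1 i ij ij1; first by have := ltn_ord i; lia.
have [lt|gt] := ltnP i j.
  case: j jn hj hj1 ij ij1 lt => // j jn hj hj1 ij ij1 lt.
  by rewrite act_ds_lt ?cls_act ?mul0rz //; lia.
case: i ij ij1 gt => -[|i] hi /= ij ij1 gt; first by lia.
by rewrite act_ds_gt ?cls_act ?mul0rz //; lia.
Qed.

Lemma cls_bd0 n (a : A n.+1) : cls a = 0 -> cls (bd a) = 0.
Proof.
apply: (@cls_eq0_hom n.+1 _ (@cls A n \o @bd A n)).
  by move=> x y /=; rewrite !raddfB.
by move=> b /degenerate_s[i [c [hi ->]]]; apply: cls_bd_s.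
Qed.

Lemma cls_bd_eq n (a b : A n.+1) : cls a = cls b -> cls (bd a) = cls (bd b).
Proof.
move=> ab; apply/eqP; rewrite -subr_eq0 -!raddfB.
by apply/eqP/cls_bd0; rewrite raddfB /= ab subrr.
Qed.

Lemma cls0_inj (a : A 0) : cls a = 0 -> a = 0.
Proof. by apply: (@cls_eq0_hom 0 _ id) => // b [m [t [c []]]]. Qed.

(** The projection [(1 - s_(r-1) d_(r-1)) o ... o (1 - s_0 d_0)]; for [r = n.+1]
    its kernel is the degenerate part and its image the Moore complex. *)
Fixpoint moore_proj n r (a : A n.+1) : A n.+1 :=
  if r is r'.+1 then moore_proj r' a - 's_r' ('d_r' (moore_proj r' a)) else a.

Lemma moore_projB n r : zmod_morphism (@moore_proj n r).
Proof.
by elim: r => // r IH a b /=; rewrite IH !raddfB /= addrACA.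
Qed.

Lemma moore_proj_face n r i (a : A n.+1) : (r <= n.+1)%N -> (i < r)%N ->
  'd_i (moore_proj r a) = 0.
Proof.
elim: r => // r IH rn /=; rewrite ltnS leq_eqVlt raddfB /= => /orP[/eqP ->|ir].
  by rewrite act_ds_id // subrr.
rewrite IH //; last by lia.
case: n a rn IH => [|n] a rn IH; first by lia.
case: r rn ir IH => //= r rn ir IH.
rewrite act_ds_lt; last by lia.
by rewrite act_dd // IH ?sab_act0 ?subrr //; lia.
Qed.

Lemma cls_moore_proj n r (a : A n.+1) : cls (moore_proj r a) = cls a.
Proof. by elim: r => //= r IH; rewrite raddfB /= IH cls_act // subr0. Qed.

(** For [r < j] the factor [1 - s_r d_r] preserves the image of [s_j], and the
    factor for [r = j] kills it. *)
Lemma moore_proj_deg n (a : A n.+1) : degenerate a -> moore_proj n.+1 a = 0.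
Proof.
case/degenerate_s => {a} j [b [jn ->]].
have im r : (r <= j)%N -> exists c, moore_proj r ('s_j b) = 's_j c.
  elim: r => [|r IH] rj; first by exists b.
  have [|c /= ->] := IH; first by lia.
  case: n {IH} b jn c => [|n] b jn c; first by lia.
  case: j jn rj => // j jn rj.
  exists (c - 's_r ('d_r c)); rewrite act_ds_lt; last by lia.
  by rewrite act_ss ?raddfB //; lia.
suff vanish m : (j < m)%N -> moore_proj m ('s_j b) = 0 by apply: vanish.
elim: m => // m IH; rewrite ltnS leq_eqVlt => /orP[/eqP <-|jm] /=.
  by have [c ->] := im j (leqnn j); rewrite act_ds_id // subrr.
by rewrite IH // !sab_act0 subr0.
Qed.

Lemma moore_proj_cls0 n (a : A n.+1) : cls a = 0 -> moore_proj n.+1 a = 0.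
Proof. exact: (cls_eq0_hom (@moore_projB n n.+1) (@moore_proj_deg n)). Qed.

Lemma moore_proj_id n r (a : A n.+1) : (r <= n.+1)%N ->
  (forall i, (i <= n)%N -> 'd_i a = 0) -> moore_proj r a = a.
Proof.
move=> rn a0; elim: r rn => //= r IH rn; rewrite IH ?a0 ?sab_act0 ?subr0 //; lia.
Qed.

Lemma moore_cls0 n (a : A n.+1) : (forall i, (i <= n)%N -> 'd_i a = 0) ->
  cls a = 0 -> a = 0.
Proof. by move=> a0 /moore_proj_cls0; rewrite moore_proj_id. Qed.

Lemma bd_moore n (a : A n.+1) : (forall i, (i <= n)%N -> 'd_i a = 0) ->
  bd a = 'd_n.+1 a *~ (-1) ^+ n.+1.
Proof.
move=> a0; rewrite /bd big_ord_recr /= big1 ?add0r // => i _.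
by rewrite a0 ?mul0rz // -ltnS.
Qed.

(** In the Moore complex the boundary is a single face up to sign, and there
    [d_(n+1) d_(n+2) = d_(n+1) d_(n+1)] vanishes. *)
Lemma cls_bd_bd n (a : A n.+2) : cls (bd (bd a)) = 0.
Proof.
pose b := moore_proj n.+2 a.
have b0 i : (i <= n.+1)%N -> 'd_i b = 0 by move=> hi; apply: moore_proj_face.
rewrite (@cls_bd_eq _ (bd a) (bd b)); last by apply: cls_bd_eq; rewrite cls_moore_proj.
rewrite (bd_moore b0) !raddfMz /= bd_moore => [|i hi]; last first.
  by rewrite act_dd ?leqW // b0 ?sab_act0 ?leqW //.
by rewrite act_dd // b0 // sab_act0 mul0rz raddf0 mul0rz.
Qed.

End NormalizedChains.

(** * Homotopy groups of simplicial abelian groups *)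

Section Moore.
Variable A : sab.
Implicit Types n : nat.

Definition sphere0 n (z : A n) : Prop :=
  forall m (t : dmap m n), (m < n)%N -> sab_act t z = 0.

Definition null n (z : A n) : Prop :=
  exists2 w : A n.+1, (forall i, (i <= n)%N -> 'd_i w = 0) & 'd_n.+1 w = z.

Definition cycle n : A n -> Prop :=
  if n is k.+1 then fun z => cls (bd z) = 0 else fun=> True.

Definition bounds n (z : A n) : Prop := exists w : A n.+1, cls z = cls (bd w).

Lemma sphere0_face n (z : A n.+1) i : sphere0 z -> 'd_i z = 0.
Proof. by apply. Qed.

Lemma faces_sphere0 n (z : A n.+1) : (forall i, (i <= n.+1)%N -> 'd_i z = 0) -> sphere0 z.
Proof.
move=> z0 m t mn; have [i ti] := dmap_missed t mn.
by rewrite (dmap_factor_cof ti) sab_act_comp z0 ?sab_act0 // -ltnS.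
Qed.

Lemma sphere0B n (a b : A n) : sphere0 a -> sphere0 b -> sphere0 (a - b).
Proof. by move=> ha hb m t mn; rewrite raddfB /= ha ?hb ?subr0. Qed.

Lemma sphere0_cycle n (z : A n) : sphere0 z -> cycle z.
Proof.
case: n z => //= n z hz; rewrite bd_moore => [|i _]; last exact: sphere0_face.
by rewrite sphere0_face // mul0rz raddf0.
Qed.

Lemma null_bounds n (z : A n) : null z -> bounds z.
Proof.
case=> w w0 <-; exists (w *~ (-1) ^+ n.+1).
by rewrite raddfMz /= bd_moore // -mulrzA -expr2 sqrr_sign mulr1z.
Qed.

(** The Moore projection of a bounding chain still bounds [z] up to degenerate
    elements, and a degenerate element of the Moore complex is zero. *)
Lemma sphere0_bounds_null n (z : A n) : sphere0 z -> bounds z -> null z.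
Proof.
move=> hz [w zw]; pose b := moore_proj n.+1 w.
have b0 i : (i <= n)%N -> 'd_i b = 0 by move=> hi; apply: moore_proj_face.
have dz : z = 'd_n.+1 b *~ (-1) ^+ n.+1.
  apply/eqP; rewrite -subr_eq0; apply/eqP.
  have : cls (z - 'd_n.+1 b *~ (-1) ^+ n.+1) = 0.
    rewrite raddfB /= zw (@cls_bd_eq _ _ w b) ?cls_moore_proj // bd_moore //.
    by rewrite subrr.
  case: n z hz w zw b b0 => [|n] z hz w zw b b0; first exact: cls0_inj.
  apply: moore_cls0 => i hi; rewrite raddfB raddfMz /= sphere0_face //.
  by rewrite act_dd ?leqW // b0 ?leqW // sab_act0 mul0rz subr0.
exists (b *~ (-1) ^+ n.+1); last by rewrite raddfMz.
by move=> i hi; rewrite raddfMz /= b0 // mul0rz.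
Qed.

Lemma cycle_sphere0 n (y : A n) : cycle y -> exists2 z, sphere0 z & cls z = cls y.
Proof.
case: n y => [|n] y hy; first by exists y => // m t.
pose z := moore_proj n.+1 y; exists z; last exact: cls_moore_proj.
have z0 i : (i <= n)%N -> 'd_i z = 0 by move=> hi; apply: moore_proj_face.
apply: faces_sphere0 => i; rewrite leq_eqVlt => /orP[/eqP ->|/z0 //].
have : cls ('d_n.+1 z) = 0.
  have := bd_moore z0; move/(congr1 (fun a => a *~ (-1) ^+ n.+1)).
  rewrite -mulrzA -expr2 sqrr_sign mulr1z => <-; rewrite raddfMz /=.
  by rewrite (@cls_bd_eq _ _ z y) ?hy ?mul0rz ?cls_moore_proj.
case: n y hy z z0 => [|n] y hy z z0; first exact: cls0_inj.
by apply: moore_cls0 => j hj; rewrite act_dd ?leqW // z0 ?leqW // sab_act0.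
Qed.

Lemma sphere0_ds n (z : A n) i : sphere0 z -> (i < n)%N -> 'd_i ('s_n z) = 0.
Proof.
case: n z => // n z hz ni.
by rewrite act_ds_lt ?leqnn ?andbT // sphere0_face ?sab_act0.
Qed.

Lemma sphereE (v : A 0) n (x : A n) :
  @sphere (U A) v n x <-> sphere0 (x - sab_act (dconst n) v).
Proof.
have dc m (t : dmap m n) : sab_act t (sab_act (dconst n) v) = sab_act (dconst m) v.
  by rewrite -sab_act_comp; congr (sab_act _ v); apply: dmap_to0.
split=> h m t mn.
  by apply/eqP; rewrite raddfB /= dc subr_eq0; apply/eqP/(h m t mn).
by apply/eqP; have /eqP := h m t mn; rewrite raddfB /= dc subr_eq0.
Qed.

(** Subtracting the constant homotopy of [x] turns a homotopy from [x] to [y] at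
    [v] into a null-homotopy of [y - x]. *)
Lemma sphere_homotopicE (v : A 0) n (x y : A n) : @sphere (U A) v n x ->
  @sphere_homotopic (U A) v n x y <-> null (y - x).
Proof.
move/sphereE => hx; set x0 := x - _ in hx.
pose c : A n.+1 := sab_act (dconst n.+1) v + 's_n x0.
have dc i : 'd_i (sab_act (dconst n.+1) v) = sab_act (dconst n) v.
  by rewrite -sab_act_comp; congr (sab_act _ v); apply: dmap_to0.
have c0 i : (i < n)%N -> 'd_i c = sab_act (dconst n) v.
  by move=> ni; rewrite raddfD /= dc sphere0_ds ?addr0.
have c1 : 'd_n c = x by rewrite raddfD /= dc act_ds_id // addrC subrK.
have c2 : 'd_n.+1 c = x by rewrite raddfD /= dc act_dSs_id // addrC subrK.
clearbody c; have faceE (i : 'I_n.+2) (w : A n.+1) : @face (U A) n i w = 'd_i w.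
  by rewrite /face dcoface_cof.
split=> [[w [wy wx w0]]|[w w0 wyx]].
  exists (w - c); last first.
    by rewrite raddfB /= c2; congr (_ - _); rewrite -wy faceE.
  move=> i; rewrite leq_eqVlt raddfB /= => /orP[/eqP ->|ni].
    by rewrite c1 -wx faceE inordK ?subrr.
  have hi : (i < n.+2)%N by lia.
  have := w0 (Ordinal hi) ni; rewrite faceE c0 //= => ->.
  by apply/eqP; rewrite subr_eq0.
exists (w + c); split=> [||i ni]; rewrite faceE raddfD /=.
- by rewrite wyx c2 subrK.
- by rewrite (inordK (leqnSn n.+1)) (w0 n (leqnn n)) c1 add0r.
- by rewrite (w0 i (ltnW ni)) (c0 i ni) add0r.
Qed.

End Moore.

Lemma cycle0 (A : sab) n : cycle (0 : A n).
Proof. by case: n => //= n; rewrite !raddf0. Qed.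

Lemma bounds0 (A : sab) n (a : A n) : cls a = 0 -> bounds a.
Proof. by move=> a0; exists 0; rewrite !raddf0. Qed.

Lemma boundsB (A : sab) n (a b : A n) : bounds a -> bounds b -> bounds (a - b).
Proof. by case=> [u hu] [w hw]; exists (u - w); rewrite !raddfB /= hu hw. Qed.

Lemma boundsD (A : sab) n (a b : A n) : bounds a -> bounds b -> bounds (a + b).
Proof.
move=> ha hb; rewrite -[b]opprK; apply: boundsB => //; rewrite -sub0r.
by apply: boundsB => //; apply: bounds0; rewrite raddf0.
Qed.

Lemma shom_cls0 A B (f : shom A B) n (a : A n) : cls a = 0 -> cls (f n a) = 0.
Proof.
apply: (@cls_eq0_hom A n _ (@cls B n \o f n)) => [x y /=|b].
  by rewrite !raddfB.
by case=> m [t [c [mn ->]]] /=; rewrite shom_nat cls_act.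
Qed.

Lemma shom_cls_eq A B (f : shom A B) n (a b : A n) :
  cls a = cls b -> cls (f n a) = cls (f n b).
Proof.
move=> ab; apply/eqP; rewrite -subr_eq0 -!raddfB.
by apply/eqP/shom_cls0; rewrite raddfB /= ab subrr.
Qed.

Lemma shom_cycle A B (f : shom A B) n (a : A n) : cycle a -> cycle (f n a).
Proof. by case: n a => //= n a ca; rewrite -shom_bd shom_cls0. Qed.

Lemma shom_bounds A B (f : shom A B) n (a : A n) : bounds a -> bounds (f n a).
Proof. by case=> w aw; exists (f n.+1 w); rewrite -shom_bd; apply: shom_cls_eq. Qed.

Lemma shom_sphere0 A B (f : shom A B) n (a : A n) : sphere0 a -> sphere0 (f n a).
Proof. by move=> ha m t mn; rewrite -shom_nat ha // shom0. Qed.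

(** Spheres at zero are the Moore cycles, and a normalized cycle has a Moore cycle
    as representative, so the homotopy groups are the homology groups of the
    normalized chains. *)
Lemma quasi_iso_weak_equiv A B (f : shom A B) :
  (forall n (z : A n), cycle z -> bounds (f n z) -> bounds z) ->
  (forall n (y : B n), cycle y -> exists2 x, cycle x & bounds (y - f n x)) ->
  weak_equiv f.
Proof.
move=> fI fS n v; split=> [x x' hx hx'|y hy].
  have fx : @sphere (U B) (f 0%N v) n (f n x).
    apply/sphereE; rewrite -shom_nat -raddfB.
    by apply: shom_sphere0; apply/sphereE.
  move/(sphere_homotopicE (f n x') fx); rewrite -raddfB => /null_bounds h.
  apply/sphere_homotopicE => //.
  have s0 : sphere0 (x' - x : A n).
    move/sphereE: hx => hx; move/sphereE: hx' => hx'.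
    by have := sphere0B hx' hx; rewrite opprB addrA subrK.
  by apply: sphere0_bounds_null => //; apply: fI => //; apply: sphere0_cycle.
move/sphereE: hy => hy; have [x cx [w bx]] := fS _ _ (sphere0_cycle hy).
have [z hz zx] := cycle_sphere0 cx.
have sz : @sphere (U A) v n (z + sab_act (dconst n) v).
  by apply/sphereE; rewrite addrK.
exists (z + sab_act (dconst n) v) => //.
have fz : @sphere (U B) (f 0%N v) n (f n (z + sab_act (dconst n) v)).
  apply/sphereE; rewrite -shom_nat -raddfB /= addrK.
  exact: shom_sphere0.
apply/sphere_homotopicE => //.
rewrite -[U_map f n _]/(f n (z + sab_act (dconst n) v)) raddfD /= shom_nat.
have -> : y - (f n z + sab_act (dconst n) (f 0%N v)) =
  (y - sab_act (dconst n) (f 0%N v)) - f n z by rewrite opprD addrCA addrC.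
apply: sphere0_bounds_null; first by apply: sphere0B => //; apply: shom_sphere0.
exists w; rewrite -bx !raddfB /=; congr (_ - _); exact: shom_cls_eq.
Qed.

Lemma inverse_weak_equiv A B (f : shom A B) (h : shom B A) :
  (forall n, cancel (f n) (h n)) -> (forall n, cancel (h n) (f n)) -> weak_equiv f.
Proof.
move=> fK hK; apply: quasi_iso_weak_equiv => n z.
  by move=> _ /(shom_bounds h); rewrite fK.
move=> cz; exists (h n z); first exact: shom_cycle.
by rewrite hK subrr; apply: bounds0; rewrite raddf0.
Qed.

Definition acyclic_at (A : sab) n : Prop := forall z : A n, cycle z -> bounds z.

Lemma acyclic_at_null A n :
  acyclic_at A n <-> forall z : A n, sphere0 z -> null z.
Proof.
split=> [h z hz|h y /cycle_sphere0[z hz zy]].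
  by apply: sphere0_bounds_null => //; apply: h; apply: sphere0_cycle.
by have /null_bounds[w zw] := h z hz; exists w; rewrite -zy.
Qed.

Lemma sphere_at0 (A : sab) n (x : A n) : @sphere (U A) 0 n x <-> sphere0 x.
Proof. by rewrite sphereE sab_act0 subr0. Qed.

Lemma sphere0_0 (A : sab) n : sphere0 (0 : A n).
Proof. by move=> m t _; rewrite raddf0. Qed.

Lemma weak_equiv_null A B (f : shom A B) n (z : A n) : weak_equiv f ->
  sphere0 z -> null (f n z) -> null z.
Proof.
move=> /(_ n 0) [/= fI _] hz fz.
have : @sphere_homotopic (U A) 0 n 0 z.
  apply: fI; [exact/sphere_at0/sphere0_0|exact/sphere_at0|].
  apply/sphere_homotopicE; rewrite !shom0 ?subr0 //; exact/sphere_at0/sphere0_0.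
by move/(sphere_homotopicE _); rewrite subr0; apply; apply/sphere_at0/sphere0_0.
Qed.

Lemma weak_equiv_sphere A B (f : shom A B) n (y : B n) : weak_equiv f ->
  sphere0 y -> exists2 x, sphere0 x & null (y - f n x).
Proof.
move=> /(_ n 0) [_ /= fS] hy.
have [|x /sphere_at0 hx] := fS y; first by rewrite shom0; apply/sphere_at0.
move/(sphere_homotopicE _) => h; exists x => //; apply: h.
by rewrite shom0; apply/sphere_at0/shom_sphere0.
Qed.

Lemma weak_equiv_acyclic_at A B (f : shom A B) n : weak_equiv f ->
  acyclic_at A n <-> acyclic_at B n.
Proof.
move=> fw; rewrite !acyclic_at_null; split=> h z hz.
  have [x hx [w w0 wzx]] := weak_equiv_sphere fw hz.
  have [w' w0' wx'] := h x hx.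
  exists (w + f n.+1 w'); last by rewrite raddfD /= wzx -shom_nat wx' subrK.
  by move=> i hi; rewrite raddfD /= w0 // -shom_nat w0' // shom0 addr0.
by apply: (weak_equiv_null fw) => //; apply/h/shom_sphere0.
Qed.

(** * 1-connectedness and the homology groups H_0 and H_1 *)

Lemma faceE (X : sset) n (i : 'I_n.+2) (x : X n.+1) : face i x = sact (cof n i) x.
Proof. by rewrite /face dcoface_cof. Qed.

Section EdgePathChains.
Variables (X : sset) (A : sab) (g : smap X (U A)).

Definition edge_chain (a : oedge X) : A 1%N := if a.1 then g 1%N a.2 else - g 1%N a.2.

Definition path_chain (p : seq (oedge X)) : A 1%N := \sum_(a <- p) edge_chain a.

Lemma bd_path_chain x p y : edge_path x p y -> bd (path_chain p) = g 0%N y - g 0%N x.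
Proof.
rewrite /path_chain; elim: p x => [|a p IH] x /=.
  by move=> ->; rewrite big_nil raddf0 subrr.
case=> <- /IH h; rewrite big_cons raddfD /= h addrC.
suff -> : bd (edge_chain a) = g 0%N (otgt a) - g 0%N (osrc a) by rewrite addrA subrK.
case: a {h} => -[] e; rewrite /edge_chain /osrc /otgt /= ?raddfN /= bd1E !faceE !smap_nat //=.
by rewrite opprB.
Qed.

(** On chains the three relations of the fundamental groupoid become a
    cancellation, a degenerate edge and the boundary of a 2-simplex. *)
Lemma path_homotopic_bounds x y p q : path_homotopic x y p q ->
  bounds (path_chain p - path_chain q).
Proof.
have b0 : bounds (0 : A 1%N) by apply: bounds0; rewrite raddf0.
rewrite /path_chain; elim=> {p q} [l p q r pq _ _|p _|p q _ IH|p q r _ IH1 _ IH2].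
- rewrite !big_cat /= opprD addrACA subrr add0r opprD addrACA subrr addr0.
  case: pq => {p q} [a|z|s]; rewrite ?big_cons ?big_nil ?addr0 ?subr0.
  + suff -> : edge_chain a + edge_chain (orev a) = 0 by [].
    by case: a => -[] e; rewrite /edge_chain /orev /= ?subrr ?addNr.
  + by apply: bounds0; rewrite /edge_chain /= /degen smap_nat cls_act.
  + exists (g 2 s); rewrite /edge_chain /= !faceE !smap_nat inordK // bd2E.
    by rewrite [in RHS]addrAC; congr (cls (_ - _)); rewrite addrC.
- by rewrite subrr.
- by rewrite -opprB -sub0r; apply: boundsB.
- by rewrite -[_ - _](subrKA (\sum_(a <- q) edge_chain a)); apply: boundsD.
Qed.

End EdgePathChains.

Section EdgePaths.
Variable X : sset.
Implicit Types (x y : X 0%N) (p q : seq (oedge X)).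

Lemma edge_path_cat x y z p q :
  edge_path x p y -> edge_path y q z -> edge_path x (p ++ q) z.
Proof.
by elim: p x => [|a p IH] x /= => [->//|[<- /IH h /h]].
Qed.

Definition path_rev p : seq (oedge X) := rev (map (@orev X) p).

Lemma edge_path_rev x y p : edge_path x p y -> edge_path y (path_rev p) x.
Proof.
rewrite /path_rev; elim: p x => [|a p IH] x /= => [->//|[<- /IH h]].
rewrite rev_cons -cats1; apply: edge_path_cat h _.
by case: a => -[] e.
Qed.

Lemma path_chain_rev (A : sab) (g : smap X (U A)) p :
  path_chain g (path_rev p) = - path_chain g p.
Proof.
rewrite /path_chain /path_rev big_rev big_map -sumrN; apply: eq_bigr => -[[] e] _.
  by [].
by rewrite /edge_chain /= opprK.
Qed.

Lemma path_homotopic_cons a x y p q : osrc a = x ->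
  path_homotopic (otgt a) y p q -> path_homotopic x y (a :: p) (a :: q).
Proof.
move=> ax; elim=> {p q} [l p q r pq h1 h2|p h|p q _|p q r _ h1 _ h2].
- by rewrite -!cat_cons; apply: PathStep.
- exact: PathRefl.
- exact: PathSym.
- exact: PathTrans h1 h2.
Qed.

Lemma path_step p q x y : edge_rel p q -> edge_path x p y -> edge_path x q y ->
  path_homotopic x y p q.
Proof.
by move=> pq h1 h2; have := @PathStep X x y [::] p q [::] pq; rewrite /= !cats0; apply.
Qed.

End EdgePaths.

Lemma act_dconst (A : sab) (x : A 0%N) : sab_act (dconst 1) x = 's_0 x.
Proof. by congr (sab_act _ x); apply: dmap_to0. Qed.

Lemma act_dmap00 (A : sab) (t : dmap 0 0) (x : A 0%N) : sab_act t x = x.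
Proof. by rewrite (dmap_to0 t (did 0)) sab_act_id. Qed.

(** In a simplicial abelian group every edge path is homotopic to one edge: the
    explicit 2-simplices below compose edges and divide by them. *)
Lemma edge_path_edge (A : sab) (x y : A 0%N) p : @edge_path (U A) x p y ->
  exists e : A 1%N, [/\ 'd_1 e = x, 'd_0 e = y &
    @path_homotopic (U A) x y p [:: (true, e : U A 1%N)]].
Proof.
elim: p x => [|[b e] q IH] x /=.
  move=> <-; exists ('s_0 x); rewrite act_ds_id // act_dSs_id //; split=> //.
  rewrite -act_dconst; apply: PathSym; apply: path_step (EdgeDegen _) _ _ => //=.
  by split; rewrite -sab_act_comp act_dmap00.
case=> sx /[dup] hq /IH[w [w1 w0 qw]]; case: b sx hq w1 qw => sx hq w1 qw.
  move: sx hq w1 qw; rewrite /osrc /otgt /= ?faceE !dcoface_cof /= => sx hq w1 qw.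
  set v := 'd_0 e in w1 qw.
  pose s : A 2 := 's_1 e + ('s_0 w - 's_0 ('s_0 v)).
  have s2 : 'd_2 s = e.
    rewrite /s raddfD raddfB /= act_dSs_id // act_ds_gt // act_ds_gt // w1.
    by rewrite act_dSs_id // subrr addr0.
  have s0 : 'd_0 s = w.
    by rewrite /s raddfD raddfB /= act_ds_lt // !act_ds_id // addrCA subrr addr0.
  have tr := @EdgeTriangle (U A) s; rewrite !faceE inordK //= s2 s0 in tr.
  have e1 : 'd_1 ('d_1 s) = x by rewrite -act_dd // s2.
  have e0 : 'd_0 ('d_1 s) = y by rewrite act_dd // s0.
  exists ('d_1 s); split=> //.
  apply: PathTrans (path_homotopic_cons (a := (true, e : U A 1%N)) _ _) _.
  - by rewrite /osrc /= dcoface_cof.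
  - by rewrite /otgt /= dcoface_cof; apply: qw.
  by apply: path_step tr _ _ => /=; rewrite !dcoface_cof /= ?sx ?w1 ?w0.
move: sx hq w1 qw; rewrite /osrc /otgt /= ?faceE !dcoface_cof /= => sx hq w1 qw.
set v := 'd_1 e in w1 qw.
pose s : A 2 := 's_1 e + 's_0 (w - e).
have s2 : 'd_2 s = e.
  rewrite /s raddfD raddfB /= act_dSs_id // raddfB /= !act_ds_gt // w1.
  by rewrite subrr addr0.
have s1 : 'd_1 s = w.
  by rewrite /s raddfD /= act_ds_id // act_dSs_id // addrC subrK.
have tr := @EdgeTriangle (U A) s; rewrite !faceE inordK //= s2 s1 in tr.
have e1 : 'd_1 ('d_0 s) = x by rewrite -act_dd // s2.
have e0 : 'd_0 ('d_0 s) = y by rewrite -act_dd // s1.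
exists ('d_0 s); split=> //.
apply: PathTrans (path_homotopic_cons (a := (false, e : U A 1%N)) _ _) _.
- by rewrite /osrc /= dcoface_cof.
- by rewrite /otgt /= dcoface_cof; apply: qw.
apply: (@PathTrans _ _ _ _ [:: (false, e); (true, e); (true, 'd_0 s)]).
  apply/PathSym/(@PathStep (U A) x y [:: (false, e : U A 1%N)] _ _ [::] tr) => /=.
    by rewrite !dcoface_cof /= sx e1 e0.
  by rewrite !dcoface_cof /= sx w1 w0.
apply: (@PathStep (U A) x y [::] _ _ [:: (true, 'd_0 s : U A 1%N)]
  (EdgeCancel (false, e : U A 1%N))) => /=.
  by rewrite !dcoface_cof /= sx e1 e0.
by rewrite !dcoface_cof /= e1 e0.
Qed.

Lemma one_connected_sab (A : sab) :
  one_connected (U A) <-> acyclic_at A 0 /\ acyclic_at A 1.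
Proof.
pose g : smap (U A) (U A) := smap_id (U A).
split=> [[_ conn simply]|[h0 h1]].
  split=> [z _|z hz].
    have [p hp] := conn (0 : A 0%N) z; exists (path_chain g p).
    by rewrite (bd_path_chain g hp) subr0.
  have {}hz : 'd_0 z = 'd_1 z by apply/eqP; rewrite -subr_eq0 -bd1E (cls0_inj hz).
  have := simply ('d_1 z) [:: (true, z : U A 1%N)].
  case/(_ _)/(path_homotopic_bounds g) => [|w].
    by rewrite /= /osrc /otgt /= !dcoface_cof /= hz.
  by rewrite /path_chain big_cons !big_nil addr0 subr0 => hw; exists w.
split=> [|x y|x p hp]; first by exists (0 : A 0%N).
  have [w] := h0 (y - x : A 0%N) Logic.I => /eqP; rewrite -subr_eq0 -raddfB => /eqP/cls0_inj hw.
  have {}hw : y - x = 'd_0 w - 'd_1 w by apply/eqP; rewrite -subr_eq0 -bd1E hw.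
  pose e : A 1%N := w + 's_0 (x - 'd_1 w).
  exists [:: (true, e : U A 1%N)]; rewrite /= /osrc /otgt /= !dcoface_cof /=.
  split; rewrite raddfD /= ?act_ds_id ?act_dSs_id //; first by rewrite addrC subrK.
  by rewrite addrCA -hw addrC subrK.
have [e [e1 e0 pe]] := edge_path_edge hp; apply: PathTrans pe _.
have /acyclic_at_null/(_ (e - 's_0 x)) := h1; case=> [|w w0 w2].
  apply: faces_sphere0 => -[|[|//]] _; rewrite raddfB /= ?act_ds_id ?act_dSs_id // ?e0 ?e1 subrr //.
pose s : A 2 := w + 's_0 ('s_0 x).
have s2 : 'd_2 s = e by rewrite raddfD /= w2 act_ds_gt // act_dSs_id // subrK.
have s0 : 'd_0 s = 's_0 x by rewrite raddfD /= w0 // act_ds_id // add0r.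
have s1 : 'd_1 s = 's_0 x by rewrite raddfD /= w0 // act_dSs_id // add0r.
have tr := @EdgeTriangle (U A) s; rewrite !faceE inordK //= s2 s1 s0 in tr.
have dg := @EdgeDegen (U A) x; rewrite /degen /= act_dconst in dg.
have x1 : 'd_1 ('s_0 x) = x by rewrite act_dSs_id.
have x0 : 'd_0 ('s_0 x) = x by rewrite act_ds_id.
apply: (@PathTrans (U A) x x _ [:: (true, e : U A 1%N); (true, 's_0 x : U A 1%N)]).
  apply/PathSym/(@PathStep (U A) x x [:: (true, e : U A 1%N)] _ _ [::] dg) => /=.
    by rewrite !dcoface_cof /= e1 e0 x1 x0.
  by rewrite !dcoface_cof /= e1 e0.
apply: (@PathTrans (U A) x x _ [:: (true, 's_0 x : U A 1%N)]).
  by apply: path_step tr _ _; rewrite /= !dcoface_cof /= ?e1 ?e0 ?x1 ?x0.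
by apply: path_step dg _ _; rewrite /= ?dcoface_cof /= ?x1 ?x0.
Qed.

(** Let [P v] be the chain of a path from the base point to [v]. The loop through
    the path to [d_1 e], the edge [e] and the reversed path to [d_0 e] is
    contractible, so [e] equals [P (bd e)] modulo boundaries. *)
Lemma one_connected_Zt (X : psset) : one_connected X ->
  acyclic_at (Zt X) 0 /\ acyclic_at (Zt X) 1.
Proof.
case=> _ conn simply; pose pt := bpt X 0; pose g := psmap_smap (eta X).
have /choice[q hq] : forall x, exists p, edge_path pt p x /\ (x = pt -> p = [::]).
  move=> x; have [->|xpt] := pselect (x = pt); first by exists [::].
  by have [p hp] := conn pt x; exists p.
pose P : Zt X 0%N -> Zt X 1%N := zrlift (fun x => path_chain g (q x)).
have P0 : path_chain g (q pt) = 0 by rewrite (hq pt).2 // /path_chain big_nil.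
have PB : zmod_morphism P := zrlift_zmod (f := fun x => path_chain g (q x)) P0.
have PE x : P (zcl pt x) = path_chain g (q x) := zrliftE (f := fun x => path_chain g (q x)) P0 x.
split=> [z _|z hz].
  exists (P z); congr cls; apply: (@zred_ext _ pt _ id (fun a => bd (P a))) => //.
    by move=> a b; rewrite PB raddfB.
  move=> x; rewrite PE (bd_path_chain g (hq x).1) /= /Zt_ab zcl_pt.
  by rewrite subr0.
suff : bounds (z - P (bd z)).
  by rewrite (cls0_inj hz) (zmod_morphism0 PB) subr0.
move: z {hz}; apply: Zt_ind => [|a b ha hb|e].
- by rewrite raddf0 (zmod_morphism0 PB) subrr; apply: bounds0; rewrite raddf0.
- suff -> : a - b - P (bd (a - b)) = (a - P (bd a)) - (b - P (bd b)) by apply: boundsB.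
  by rewrite raddfB PB !opprD addrACA.
have -> : bd (zcl (bpt X 1) e : Zt X 1%N) =
    zcl pt (face ord0 e) - zcl pt (face ord_max e) :> Zt X 0%N.
  by rewrite bd1E !faceE /= !Zt_actE.
rewrite PB !PE; pose p := q (face ord_max e) ++ (true, e) :: path_rev (q (face ord0 e)).
have hp : edge_path pt p pt.
  apply: (edge_path_cat (hq _).1); split=> //=.
  by rewrite /otgt /=; apply: edge_path_rev; apply: (hq _).1.
have /(path_homotopic_bounds g) := simply pt p hp.
rewrite /path_chain big_nil subr0 big_cat big_cons /= -!/(path_chain g _) path_chain_rev.
by rewrite opprB addrCA.
Qed.

(** * A simply connected space with the same homology *)

Notation gen x := (zcl (bpt _ _) x : Zt _ _).

Section Cells.
Variable X : psset.

Notation A := (Zt X).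

(** A 2-simplex of [X] or the 2-cell of a vertex, with a sign that is positive for
    [true]. *)
Definition letter : Type := (bool * (X 2 + X 0%N))%type.

(** The cell [inl v] carries the vertex [v] into dimension 2, and [inr (l, s)] is
    to be the sum of the word [l :: s]. *)
Definition cell2 : Type := (X 0%N + letter * seq letter)%type.

(** The cell [inl (l, s)] attaches the 2-cell of [l :: s], and [inr e] kills the
    word of the edge [e]. *)
Definition cell3 : Type := (letter * seq letter + X 1%N)%type.

Variable word : X 1%N -> seq letter.

Definition tri : Type := (X 2 + cell2)%type.

Definition word_tri (s : seq letter) : tri :=
  if s is l :: s' then inr (inr (l, s')) else inl (bpt X 2).

Definition letter_tri (l : letter) : tri :=
  match l.2 with inl x => inl x | inr v => inr (inl v) end.

(** The faces are chosen so that the alternating sum of the faces of [inl (l, s)]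
    is [x - w' + w] for a positive and [x - w + w'] for a negative letter over the
    2-simplex [x], where [w] and [w'] are the triangles of [s] and [l :: s]. *)
Definition face3 (c : cell3) (j : nat) : tri :=
  match c with
  | inl (l, s) =>
    match j with
    | 0 => letter_tri l
    | 1 => word_tri (if l.1 then l :: s else s)
    | 2 => word_tri (if l.1 then s else l :: s)
    | _ => inl (bpt X 2)
    end
  | inr e => if j is 0 then word_tri (word e) else inl (bpt X 2)
  end.

Definition tri_val_type : zmodType := (nch A 2 * A 0%N * zab (letter * seq letter))%type.

Definition letter_sum (l : letter) : A 2 * A 0%N :=
  let u := match l.2 with inl x => (gen x, 0) | inr v => (0, gen v) end in
  if l.1 then u else - u.

Definition word_sum (s : seq letter) : A 2 * A 0%N := \sum_(l <- s) letter_sum l.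

(** The signed formal sum of the nonempty suffixes. The code of the boundary of
    the 3-cell [inl (l, s)] is then the generator of [(l, s)] alone, so a
    combination of these 3-cells can be read off from its boundary. *)
Fixpoint word_code (s : seq letter) : zab (letter * seq letter) :=
  if s is l :: s' then
    word_code s' + (if l.1 then - zgen (l, s') else zgen (l, s'))
  else 0.

Definition word_val (s : seq letter) : tri_val_type :=
  (cls (word_sum s).1, (word_sum s).2, word_code s).

Definition tri_val (c : tri) : tri_val_type :=
  match c with
  | inl x => (cls (gen x), 0, 0)
  | inr (inl v) => (0, gen v, 0)
  | inr (inr (l, s)) => word_val (l :: s)
  end.

(** The disjoint union of [X] and of a copy of [Delta[2]] or [Delta[3]] for each
    cell, before any gluing. *)
Inductive simplices n : Type :=
| SX of X n
| S2 of cell2 & dmap n 2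
| S3 of cell3 & dmap n 3.

Definition simplices_act m n (t : dmap m n) (w : simplices n) : simplices m :=
  match w with
  | SX x => SX (sact t x)
  | S2 c s => S2 c (dcomp s t)
  | S3 c s => S3 c (dcomp s t)
  end.

Lemma simplices_act_id n w : simplices_act (did n) w = w.
Proof. by case: w => [x|c s|c s] /=; rewrite ?sact_id ?dcomp1r. Qed.

Lemma simplices_act_comp m n p (g : dmap n p) (f : dmap m n) w :
  simplices_act (dcomp g f) w = simplices_act f (simplices_act g w).
Proof. by case: w => [x|c s|c s] /=; rewrite ?sact_comp ?dcompA. Qed.

(** Dimensions 0 and 1 are collapsed; dimension 2, where the cells are glued, is
    recorded by [code2]. *)
Definition code n (w : simplices n) : nch A n :=
  if w is SX x then if (2 < n)%N then cls (gen x) else 0 else 0.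

Definition code2 (w : simplices 2) : tri_val_type :=
  match w with
  | SX x => tri_val (inl x)
  | S2 c s => if s == did 2 then tri_val (inr c) else 0
  | S3 c s => \sum_(j < 4) if s == cof 2 j then tri_val (face3 c j) else 0
  end.

(** A cofree simplicial set: operators act by precomposition. *)
Definition codes n : Type := ((forall m, dmap m n -> nch A m) * (dmap 2 n -> tri_val_type))%type.

Definition encode n (w : simplices n) : codes n :=
  (fun m t => code (simplices_act t w), fun t => code2 (simplices_act t w)).

Definition codes_act m n (t : dmap m n) (c : codes n) : codes m :=
  (fun k u => c.1 k (dcomp t u), fun u => c.2 (dcomp t u)).

Lemma codes_ext n (c d : codes n) :
  (forall m t, c.1 m t = d.1 m t) -> (forall t, c.2 t = d.2 t) -> c = d.
Proof.
case: c d => [c1 c2] [d1 d2] /= h1 h2; congr pair; last exact: funext.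
by apply: functional_extensionality_dep => m; apply: funext => t; apply: h1.
Qed.

Lemma encode_act m n (t : dmap m n) w : encode (simplices_act t w) = codes_act t (encode w).
Proof. by apply: codes_ext => [k|] u; rewrite /= simplices_act_comp. Qed.

(** Two simplices are glued when all simplices obtained from them by operators
    have equal codes. The image of [encode] is closed under the operators, so
    the quotient is a simplicial set by construction, and the codes are
    functions on it which extend additively to chains and vanish on degenerate
    ones. *)
Definition plus_simplex n : Type := {c : codes n | exists w, c = encode w}.

Lemma plus_simplex_ext n (a b : plus_simplex n) : sval a = sval b -> a = b.
Proof.
by case: a b => [a ha] [b hb] /= ab; case: _ / ab hb => hb; rewrite (Prop_irrelevance ha hb).
Qed.

Lemma plus_act_subproof m n (t : dmap m n) (c : codes n) :
  (exists w, c = encode w) -> exists w, codes_act t c = encode w.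
Proof. by case=> w ->; exists (simplices_act t w); rewrite encode_act. Qed.

Definition plus_act m n (t : dmap m n) (a : plus_simplex n) : plus_simplex m :=
  exist _ (codes_act t (sval a)) (plus_act_subproof t (svalP a)).

Lemma plus_act_id n a : plus_act (did n) a = a.
Proof. by apply: plus_simplex_ext; apply: codes_ext => [k|] u; rewrite /= dcomp1l. Qed.

Lemma plus_act_comp m n p (g : dmap n p) (f : dmap m n) a :
  plus_act (dcomp g f) a = plus_act f (plus_act g a).
Proof. by apply: plus_simplex_ext; apply: codes_ext => [k|] u; rewrite /= dcompA. Qed.

Definition plus_sset : sset := SSet plus_act_id plus_act_comp.

Definition simplex_cl n (w : simplices n) : plus_sset n :=
  exist _ (encode w) (ex_intro _ w erefl).

Lemma simplex_clP n (a : plus_sset n) : exists w, a = simplex_cl w.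
Proof. by case: a => c [w e]; exists w; apply: plus_simplex_ext. Qed.

Lemma simplex_cl_act m n (t : dmap m n) w :
  sact t (simplex_cl w) = simplex_cl (simplices_act t w).
Proof. by apply: plus_simplex_ext; rewrite /= encode_act. Qed.

Lemma plus_bpt_act m n (t : dmap m n) :
  sact t (simplex_cl (SX (bpt X n))) = simplex_cl (SX (bpt X m)).
Proof. by rewrite simplex_cl_act /= bpt_act. Qed.

Definition plus : psset := PSSet plus_bpt_act.

Lemma plus_incl_nat m n (t : dmap m n) (x : X n) :
  simplex_cl (SX (sact t x)) = sact t (simplex_cl (SX x)).
Proof. by rewrite simplex_cl_act. Qed.

Definition plus_incl : psmap X plus :=
  @PSMap X plus (@SMap X plus (fun n x => simplex_cl (SX x)) plus_incl_nat) (fun=> erefl).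

Lemma simplex_cl_eq n (w w' : simplices n) :
  (forall m (t : dmap m n), code (simplices_act t w) = code (simplices_act t w')) ->
  (forall t : dmap 2 n, code2 (simplices_act t w) = code2 (simplices_act t w')) ->
  simplex_cl w = simplex_cl w'.
Proof. by move=> h1 h2; apply: plus_simplex_ext; apply: codes_ext. Qed.

Lemma code_act m n (t : dmap m n) (w : simplices n) : (n < m)%N ->
  code (simplices_act t w) = 0.
Proof.
move=> nm; case: w => //= x; case: ifP => // _.
by rewrite eta_nat cls_act.
Qed.

Lemma code2_act n (t : dmap 2 n) (w : simplices n) : ~ injective t ->
  code2 (simplices_act t w) = 0.
Proof.
move=> tI; case: w => [x|c s|c s] /=.
- have [i hi e] := dmap_factor_cod tI.
  by rewrite e sact_comp eta_nat cls_act.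
- case: eqP => // e; case: tI => j k jk.
  by have := congr1 s jk; rewrite -!dcompE e !didE.
- rewrite big1 // => i _; case: eqP => // e; case: tI => j k jk.
  by have := congr1 s jk; rewrite -!dcompE e => /cof_injective.
Qed.

Lemma code_bpt m n (t : dmap m n) : code (simplices_act t (SX (bpt X n))) = 0.
Proof. by rewrite /= bpt_act zcl_pt raddf0 if_same. Qed.

Lemma code2_bpt n (t : dmap 2 n) : code2 (simplices_act t (SX (bpt X n))) = 0.
Proof. by rewrite /= bpt_act zcl_pt raddf0. Qed.

Lemma simplex_cl_bpt n (w : simplices n) :
  (forall m (t : dmap m n), code (simplices_act t w) = 0) ->
  (forall t : dmap 2 n, code2 (simplices_act t w) = 0) ->
  simplex_cl w = bpt plus n.
Proof.
by move=> h1 h2; apply: simplex_cl_eq => [m|] t; rewrite ?code_bpt ?code2_bpt.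
Qed.

(** A simplex of dimension at most 1 yields only degenerate simplices of dimension
    at least 2, and those have code zero. *)
Lemma plus_reduced n (a : plus n) : (n <= 1)%N -> a = bpt plus n.
Proof.
move=> n1; have [w ->] := simplex_clP a; apply: simplex_cl_bpt => [m|] t.
  have [nm|mn] := ltnP n m; first exact: code_act.
  case: w => //= x; case: ifP => // m2; lia.
by apply: code2_act; apply: dmap_pigeon; lia.
Qed.

Lemma one_connected_plus : one_connected plus.
Proof.
have v0 (v w : plus 0%N) : v = w by rewrite [v]plus_reduced // [w]plus_reduced.
split=> [|x y|x p]; first by exists (bpt plus 0).
  by exists [::]; apply: v0.
have ep q : edge_path x q x.
  elim: q {1}x => [|a q IH] y; first exact: v0.
  by split; [apply: v0|apply: IH].
move=> _; elim: p => [|[b e] p IH]; first exact: PathRefl (ep _).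
apply: PathTrans _ IH.
have -> : e = degen 1 x by rewrite [e]plus_reduced // [degen 1 x]plus_reduced.
have pos q : path_homotopic x x ((true, degen 1 x) :: q) q.
  exact: (@PathStep _ x x [::] _ _ q (EdgeDegen x) (ep _) (ep _)).
case: b; first exact: pos.
apply: PathTrans (PathSym (pos _)) _.
exact: (@PathStep _ x x [::] _ _ p (EdgeCancel (true, degen 1 x)) (ep _) (ep _)).
Qed.

Definition tri_simplex (c : tri) : simplices 2 :=
  match c with inl x => SX x | inr c => S2 c (did 2) end.

Lemma code2_tri c : code2 (tri_simplex c) = tri_val c.
Proof. by case: c => [x|c] //=; rewrite eqxx. Qed.

(** The attaching maps of the 3-cells: an operator into [Delta[2]] is the identity,
    where the codes agree by the definition of [code2], or it gives a degenerate
    simplex or one of dimension at most 1. *)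
Lemma simplex_cl_face3 (c : cell3) (j : 'I_4) :
  simplex_cl (S3 c (cof 2 j)) = simplex_cl (tri_simplex (face3 c j)).
Proof.
apply: simplex_cl_eq => [m|] t.
  have [nm|mn] := ltnP 2 m; first by rewrite !code_act.
  by case: (face3 c j) => //= x; rewrite ltnNge mn.
have [/dmap_inj_id ->|tI] := pselect (injective t); last by rewrite !code2_act.
rewrite !simplices_act_id code2_tri /= (bigD1 j) //= eqxx big1 ?addr0 // => i ij.
case: eqP => // /cof_inj e; case/eqP: ij; apply: val_inj => /=.
by rewrite e // -ltnS.
Qed.

End Cells.

(** * Chains on the plus construction *)

Section PlusChains.
Variables (X : psset) (word : X 1%N -> seq (letter X)).

Notation A := (Zt X).
Notation P := (plus word).
Notation B := (Zt P).
Notation f := (Zt_map (plus_incl word)).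

Definition simplex_chain n (w : simplices X n) : B n := gen (simplex_cl word w : P n).

Lemma simplex_chain_act m n (t : dmap m n) w :
  sab_act t (simplex_chain w) = simplex_chain (simplices_act t w).
Proof. by rewrite /= Zt_actE simplex_cl_act. Qed.

Lemma plus_chain_ind n (Q : B n -> Prop) :
  Q 0 -> (forall a b, Q a -> Q b -> Q (a - b)) -> (forall w, Q (simplex_chain w)) ->
  forall a, Q a.
Proof. by move=> Q0 QB Qg; apply: Zt_ind => // a; have [w ->] := simplex_clP a; apply: Qg. Qed.

Lemma plus_inclE n (x : X n) : f n (gen x) = simplex_chain (SX x).
Proof. exact: Zt_map_funE. Qed.

Lemma plus_chain_low n (b : B n) : (n <= 1)%N -> b = 0.
Proof.
move=> n1; move: b; apply: plus_chain_ind => [//|a b -> ->|w]; first by rewrite subrr.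
by rewrite /simplex_chain [simplex_cl _ _]plus_reduced // zcl_pt.
Qed.

Definition code_hom n : B n -> nch A n := zrlift (fun a : P n => (sval a).1 n (did n)).

Lemma code_hom_pt n : (sval (bpt P n)).1 n (did n) = 0.
Proof. exact: code_bpt. Qed.

Lemma code_hom_zmod n : zmod_morphism (@code_hom n).
Proof. exact/zrlift_zmod/code_hom_pt. Qed.

Lemma code_homE n (w : simplices X n) : code_hom (simplex_chain w) = code w.
Proof.
by rewrite /code_hom zrliftE ?code_hom_pt //= simplices_act_id.
Qed.

Lemma code_hom_cls0 n (b : B n) : cls b = 0 -> code_hom b = 0.
Proof.
apply: (cls_eq0_hom (@code_hom_zmod n)) => {b} _ [m [t [a [mn ->]]]]; move: a.
apply: plus_chain_ind => [|a b ha hb|w].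
- by rewrite raddf0 (zmod_morphism0 (@code_hom_zmod n)).
- by rewrite raddfB code_hom_zmod ha hb subrr.
- by rewrite simplex_chain_act code_homE code_act.
Qed.

Lemma code_hom_incl n (a : A n) : (2 < n)%N -> code_hom (f n a) = cls a.
Proof.
move=> n2; move: a; apply: zred_ext => [a b|a b|x]; last first.
- by rewrite plus_inclE code_homE /= n2.
- exact: raddfB.
- by rewrite raddfB code_hom_zmod.
Qed.

Definition code2_hom : B 2 -> tri_val_type X := zrlift (fun a : P 2 => (sval a).2 (did 2)).

Lemma code2_hom_pt : (sval (bpt P 2)).2 (did 2) = 0.
Proof. exact: code2_bpt. Qed.

Lemma code2_hom_zmod : zmod_morphism code2_hom.
Proof. exact/zrlift_zmod/code2_hom_pt. Qed.

HB.instance Definition _ := GRing.isZmodMorphism.Build _ _ code2_hom code2_hom_zmod.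

Lemma code2_homD b b' : code2_hom (b + b') = code2_hom b + code2_hom b'.
Proof. exact: raddfD. Qed.

Lemma code2_homE (w : simplices X 2) : code2_hom (simplex_chain w) = code2 word w.
Proof. by rewrite /code2_hom zrliftE ?code2_hom_pt //= simplices_act_id. Qed.

Lemma code2_hom_cls0 (b : B 2) : cls b = 0 -> code2_hom b = 0.
Proof.
apply: (cls_eq0_hom code2_hom_zmod) => {b} _ [m [t [a [mn ->]]]]; move: a.
apply: plus_chain_ind => [|a b ha hb|w].
- by rewrite !raddf0.
- by rewrite !raddfB /= ha hb subrr.
- by rewrite simplex_chain_act code2_homE code2_act //; apply: dmap_pigeon.
Qed.

Lemma code2_hom_cls_eq (b b' : B 2) : cls b = cls b' -> code2_hom b = code2_hom b'.
Proof.
move=> bb; apply/eqP; rewrite -subr_eq0 -raddfB.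
by apply/eqP/code2_hom_cls0; rewrite raddfB /= bb subrr.
Qed.

Lemma code2_hom_incl (a : A 2) : code2_hom (f 2 a) = (cls a, 0, 0).
Proof.
move: a; apply: zred_ext => [a b|a b|x]; last first.
- by rewrite plus_inclE code2_homE.
- by rewrite raddfB; congr (_, _, _); rewrite /= subrr.
- by rewrite !raddfB.
Qed.

(** From dimension 2 on, the code of a simplex of [X] is its normalized class. *)
Lemma plus_incl_reflects n (a : A n) : (1 < n)%N -> cls (f n a) = 0 -> cls a = 0.
Proof.
move=> n1 fa; case: (ltngtP n 2) n1 => // [n2 _|e _].
  by rewrite -code_hom_incl // code_hom_cls0.
move: a fa; rewrite e => a /code2_hom_cls0; rewrite code2_hom_incl => h.
by have := congr1 (fun u : tri_val_type X => u.1.1) h.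
Qed.

Definition tri_chain (c : tri X) : B 2 := simplex_chain (tri_simplex c).

Lemma tri_chain_bpt : tri_chain (inl (bpt X 2)) = 0.
Proof. exact: zcl_pt. Qed.

Lemma code2_tri_chain c : code2_hom (tri_chain c) = tri_val c.
Proof. by rewrite code2_homE code2_tri. Qed.

Definition vertex_chain : A 0%N -> B 2 :=
  zrlift (fun v : X 0%N => tri_chain (inr (inl v))).

(** The 2-cell of the base point has code zero, hence is glued to the base point. *)
Lemma vertex_chain_pt : tri_chain (inr (inl (bpt X 0))) = 0.
Proof.
rewrite /tri_chain /simplex_chain (_ : simplex_cl _ _ = bpt P 2) ?zcl_pt //.
apply: simplex_cl_bpt => [//|t] /=.
by rewrite zcl_pt if_same.
Qed.

Lemma vertex_chain_zmod : zmod_morphism vertex_chain.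
Proof. exact/zrlift_zmod/vertex_chain_pt. Qed.

HB.instance Definition _ := GRing.isZmodMorphism.Build _ _ vertex_chain vertex_chain_zmod.

Lemma vertex_chainE v : vertex_chain (gen v) = tri_chain (inr (inl v)).
Proof. exact/zrliftE/vertex_chain_pt. Qed.

Definition cell_chain (c : cell3 X) : B 3 := simplex_chain (S3 c (did 3)).

Lemma bd_cell_chain c : bd (cell_chain c) =
  tri_chain (face3 word c 0) - tri_chain (face3 word c 1) + tri_chain (face3 word c 2)
  - tri_chain (face3 word c 3).
Proof.
have face (j : 'I_4) : 'd_j (cell_chain c) = tri_chain (face3 word c j).
  by rewrite simplex_chain_act /= dcomp1l /tri_chain /simplex_chain simplex_cl_face3.
by rewrite bd3E (face ord0) (face (Ordinal (isT : 1 < 4)%N))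
  (face (Ordinal (isT : 2 < 4)%N)) (face ord_max).
Qed.

Definition list_chain : zab (letter X * seq (letter X)) -> B 3 :=
  zlift (fun u => cell_chain (inl u)).

HB.instance Definition _ := GRing.isZmodMorphism.Build _ _ list_chain
  (zlift_zmod (fun u => cell_chain (inl u))).

(** The 3-cell of a word exhibits its triangle as the sum of the triangle of its
    first letter and that of the rest. *)
Lemma bd_list_cell l s : bd (cell_chain (inl (l, s))) =
  if l.1 then tri_chain (letter_tri l) - tri_chain (word_tri (l :: s)) + tri_chain (word_tri s)
  else tri_chain (letter_tri l) - tri_chain (word_tri s) + tri_chain (word_tri (l :: s)).
Proof. by rewrite bd_cell_chain /= tri_chain_bpt subr0; case: l.1. Qed.

Definition incl2 (u : A 2 * A 0%N) : B 2 := f 2 u.1 + vertex_chain u.2.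

Lemma incl2E a v : incl2 (a, v) = f 2 a + vertex_chain v.
Proof. by []. Qed.

Lemma incl2_zmod : zmod_morphism incl2.
Proof.
move=> [a b] [c d]; rewrite -[(a, b) - _]/(a - c, b - d) !incl2E !raddfB.
by rewrite opprD addrACA.
Qed.

HB.instance Definition _ := GRing.isZmodMorphism.Build _ _ incl2 incl2_zmod.

Lemma incl2N u : incl2 (- u) = - incl2 u.
Proof. exact: raddfN. Qed.

Lemma incl2D u v : incl2 (u + v) = incl2 u + incl2 v.
Proof. exact: raddfD. Qed.

Lemma tri_chain_letter l : tri_chain (letter_tri l) =
  if l.1 then incl2 (letter_sum l) else - incl2 (letter_sum l).
Proof.
case: l => b [x|v]; rewrite /letter_sum /letter_tri /=; case: b;
  rewrite ?incl2N ?opprK incl2E ?plus_inclE ?vertex_chainE.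
- by rewrite raddf0 addr0.
- by rewrite raddf0 addr0.
- by rewrite shom0 add0r.
- by rewrite shom0 add0r.
Qed.

(** Induction on the word: the 3-cell of [(l, s)] splits off the letter [l]. *)
Lemma word_chain_bounds s : bounds (tri_chain (word_tri s) - incl2 (word_sum s)).
Proof.
elim: s => [|l s IH].
  by apply: bounds0; rewrite /word_sum big_nil (zmod_morphism0 incl2_zmod) tri_chain_bpt
    subrr raddf0.
rewrite /word_sum big_cons -/(word_sum s) incl2D.
set w := tri_chain _ in IH *; set w' := tri_chain _.
have bl : bounds (bd (cell_chain (inl (l, s)))) by exists (cell_chain (inl (l, s))).
have := bd_list_cell l s; rewrite tri_chain_letter -/w -/w'.
set e := bd _ in bl *; set i := incl2 _ => eE.
case: l.1 eE => eE.
  suff -> : w' - (i + incl2 (word_sum s)) = (w - incl2 (word_sum s)) - e by apply: boundsB.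
  by rewrite eE [- (i - w' + w)]opprD opprB [RHS]addrC [RHS]addrA subrK -[RHS]addrA -opprD.
suff -> : w' - (i + incl2 (word_sum s)) = (w - incl2 (word_sum s)) + e by apply: boundsD.
by rewrite eE [RHS]addrC [_ - w + w']addrAC [RHS]addrA subrK [- i + w']addrC
  -[RHS]addrA -opprD.
Qed.

End PlusChains.

(** * The plus construction preserves homology *)

(** An edge chain of class zero is a combination of degenerate edges. *)
Lemma edge_hom_cls0 (X : psset) (M : zmodType) (h : Zt X 1%N -> M) (b : Zt X 1%N) :
  zmod_morphism h -> (forall (t : dmap 1 0) (v : X 0%N), h (gen (sact t v)) = 0) ->
  cls b = 0 -> h b = 0.
Proof.
move=> hB hd; apply: (cls_eq0_hom hB) => {b} _ [m [t [a [m0 ->]]]].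
case: m m0 t a => // _ t a; move: a.
apply: Zt_ind => [|a b ha hb|v].
- by rewrite raddf0 (zmod_morphism0 hB).
- by rewrite raddfB hB ha hb subrr.
- by rewrite -(hd t v) /= Zt_actE.
Qed.

Section PlusHomology.
Variables (X : psset) (word : X 1%N -> seq (letter X)).

Notation A := (Zt X).
Notation P := (plus word).
Notation B := (Zt P).
Notation f := (Zt_map (plus_incl word)).
Notation incl2 := (@incl2 X word).
Notation tri_chain := (@tri_chain X word).
Notation cell_chain := (@cell_chain X word).
Notation list_chain := (@list_chain X word).

Variable cone : A 0%N -> A 1%N.
Hypotheses (coneB : zmod_morphism cone) (bd_cone : forall a, bd (cone a) = a).
Hypothesis word_bd : forall e, (word_sum (word e)).2 = bd (gen e).
Hypothesis word_fill : forall e,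
  cls (bd (word_sum (word e)).1) = cls (gen e - cone (bd (gen e))).
Hypothesis word_degen : forall (t : dmap 1 0) v, word (sact t v) = [::].

Lemma word_bpt : word (bpt X 1) = [::].
Proof. by rewrite -(@bpt_act X _ _ (dconst 1)) word_degen. Qed.

(** The additive extension of the chains [c_e], where [word e] spells
    [c_e + [d_0 e] - [d_1 e]]. *)
Definition edge_fill : A 1%N -> A 2 := zrlift (fun e => (word_sum (word e)).1).
Definition edge_code : A 1%N -> zab (letter X * seq (letter X)) :=
  zrlift (fun e => word_code (word e)).
Definition edge_cells : A 1%N -> B 3 := zrlift (fun e => cell_chain (inr e)).

Lemma word_sum_nil : word_sum [::] = 0 :> A 2 * A 0%N.
Proof. by rewrite /word_sum big_nil. Qed.

Lemma edge_cell_trivial e : word e = [::] -> cell_chain (inr e) = 0.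
Proof.
move=> we; rewrite /cell_chain /simplex_chain (_ : simplex_cl _ _ = bpt P 3) ?zcl_pt //.
apply: simplex_cl_bpt => [//|t] /=; rewrite big1 // => j _; case: eqP => // _.
by case: j => -[|j] hj /=; rewrite ?we /= zcl_pt raddf0.
Qed.

Lemma edge_fill_pt : (word_sum (word (bpt X 1))).1 = 0.
Proof. by rewrite word_bpt word_sum_nil. Qed.

Lemma edge_code_pt : word_code (word (bpt X 1)) = 0.
Proof. by rewrite word_bpt. Qed.

Lemma edge_cells_pt : cell_chain (inr (bpt X 1)) = 0.
Proof. exact/edge_cell_trivial/word_bpt. Qed.

Lemma edge_fillE e : edge_fill (gen e) = (word_sum (word e)).1.
Proof. exact/zrliftE/edge_fill_pt. Qed.

Lemma edge_codeE e : edge_code (gen e) = word_code (word e).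
Proof. exact/zrliftE/edge_code_pt. Qed.

Lemma edge_cellsE e : edge_cells (gen e) = cell_chain (inr e).
Proof. exact/zrliftE/edge_cells_pt. Qed.

Lemma edge_fill_zmod : zmod_morphism edge_fill.
Proof. exact/zrlift_zmod/edge_fill_pt. Qed.

Lemma edge_code_zmod : zmod_morphism edge_code.
Proof. exact/zrlift_zmod/edge_code_pt. Qed.

Lemma edge_cells_zmod : zmod_morphism edge_cells.
Proof. exact/zrlift_zmod/edge_cells_pt. Qed.

HB.instance Definition _ := GRing.isZmodMorphism.Build _ _ edge_fill edge_fill_zmod.
HB.instance Definition _ := GRing.isZmodMorphism.Build _ _ edge_code edge_code_zmod.
HB.instance Definition _ := GRing.isZmodMorphism.Build _ _ edge_cells edge_cells_zmod.
HB.instance Definition _ := GRing.isZmodMorphism.Build _ _ cone coneB.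

Lemma edge_fill_cls0 a : cls a = 0 -> edge_fill a = 0.
Proof.
apply: edge_hom_cls0; first exact: edge_fill_zmod.
by move=> t v; rewrite edge_fillE word_degen word_sum_nil.
Qed.

Lemma edge_code_cls0 a : cls a = 0 -> edge_code a = 0.
Proof.
apply: edge_hom_cls0; first exact: edge_code_zmod.
by move=> t v; rewrite edge_codeE word_degen.
Qed.

Lemma edge_cells_cls0 a : cls a = 0 -> edge_cells a = 0.
Proof.
apply: edge_hom_cls0; first exact: edge_cells_zmod.
by move=> t v; rewrite edge_cellsE edge_cell_trivial ?word_degen.
Qed.

Lemma bd_edge_fill a : cls (bd (edge_fill a)) = cls (a - cone (bd a)).
Proof.
move: a; apply: zred_ext => [a b|a b|e].
- by rewrite !raddfB.
- by rewrite -raddfB; congr cls; rewrite !raddfB /= ?opprD addrACA.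
- by rewrite edge_fillE word_fill.
Qed.

Lemma bd_edge_cell e : bd (cell_chain (inr e)) = tri_chain (word_tri (word e)).
Proof. by rewrite bd_cell_chain /= !tri_chain_bpt !subr0 addr0. Qed.

(** The 3-cell of an edge bounds the triangle of its word, which is homologous to
    the chain that the word spells. *)
Lemma edge_fill_bounds a : bounds (incl2 (edge_fill a, bd a)).
Proof.
move: a; apply: Zt_ind => [|a b ha hb|e].
- rewrite (_ : (edge_fill 0, bd 0) = 0 :> A 2 * A 0%N); last by rewrite !raddf0.
  by apply: bounds0; rewrite (zmod_morphism0 (@incl2_zmod _ _)) raddf0.
- have := boundsB ha hb; rewrite -incl2_zmod.
  by rewrite -[_ - _]/(edge_fill a - edge_fill b, bd a - bd b) -!raddfB.
have -> : (edge_fill (gen e), bd (gen e)) = word_sum (word e).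
  by rewrite edge_fillE -word_bd -surjective_pairing.
have h := @word_chain_bounds _ word (word e).
have b : bounds (tri_chain (word_tri (word e))).
  by exists (cell_chain (inr e)); rewrite bd_edge_cell.
by have := boundsB b h; rewrite opprB addrC subrK.
Qed.

Lemma tri_val_word (s : seq (letter X)) : tri_val (word_tri s) = word_val s.
Proof. by case: s => [|[l s]] //; rewrite /= zcl_pt /word_val word_sum_nil raddf0. Qed.

Lemma tri_val_letter (l : letter X) : tri_val (letter_tri l) =
  if l.1 then (cls (letter_sum l).1, (letter_sum l).2, 0)
  else - (cls (letter_sum l).1, (letter_sum l).2, 0 : zab (letter X * seq (letter X))).
Proof.
case: l => b [x|v]; rewrite /letter_sum /letter_tri /=; case: b => /=;
 rewrite ?raddf0 //.
- by congr (_, _, _); rewrite ?oppr0 //= raddfN opprK.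
- by congr (_, _, _); rewrite ?oppr0 //= ?raddf0 ?oppr0 ?opprK.
Qed.

Lemma word_val_cons (l : letter X) s : word_val (l :: s) =
  (cls (letter_sum l).1, (letter_sum l).2, 0) + word_val s +
  (0, 0, if l.1 then - zgen (l, s) else zgen (l, s)).
Proof.
rewrite /word_val {1 2}/word_sum big_cons -/(word_sum s).
by congr (_, _, _); rewrite /= ?addr0 ?add0r // raddfD.
Qed.

Lemma code2_bd_list a : code2_hom (bd (list_chain a)) = (0, 0, a).
Proof.
move: a; apply: zab_ext => [a b|a b|[l s]].
- by rewrite !raddfB.
- by congr (_, _, _); rewrite /= subrr.
rewrite /list_chain zliftE bd_list_cell.
set u : tri_val_type X := (cls (letter_sum l).1, (letter_sum l).2, 0).
have := tri_val_letter l; have := word_val_cons l s; rewrite -/u.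
have := tri_val_word (l :: s); move: (word_tri (l :: s)) => w wE.
case: l.1 => cE lE; rewrite raddfD raddfB /= !code2_tri_chain lE wE tri_val_word cE.
  by rewrite addrAC opprD addrA subrr add0r; congr (_, _, _); rewrite ?oppr0 ?opprK.
by rewrite -opprD addrA addNr add0r.
Qed.

Lemma code2_bd_edge b : code2_hom (bd (edge_cells b)) = (cls (edge_fill b), bd b, edge_code b).
Proof.
move: b; apply: zred_ext => [a b|a b|e].
- by rewrite !raddfB.
- by congr (_, _, _); rewrite !raddfB.
rewrite edge_cellsE bd_edge_cell code2_tri_chain tri_val_word /word_val.
by rewrite edge_fillE edge_codeE word_bd.
Qed.

Lemma plus_chain_ge4 n (y : B n) : (3 < n)%N -> exists x : A n, cls y = cls (f n x).
Proof.
move=> n3; move: y; apply: plus_chain_ind => [|y z [a ha] [b hb]|w].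
- by exists 0; rewrite shom0.
- by exists (a - b); rewrite !raddfB /= ha hb.
case: w => [x|c s|c s]; first by exists (gen x); rewrite plus_inclE.
  exists 0; rewrite shom0 raddf0 -[s]dcomp1l.
  by rewrite -[S2 _ _]/(simplices_act s (S2 c (did 2))) -simplex_chain_act cls_act // ltnW.
exists 0; rewrite shom0 raddf0 -[s]dcomp1l.
by rewrite -[S3 _ _]/(simplices_act s (S3 c (did 3))) -simplex_chain_act cls_act.
Qed.

Lemma plus_chain3 (y : B 3) : exists x a b,
  cls y = cls (f 3 x + list_chain a + edge_cells b).
Proof.
move: y; apply: plus_chain_ind => [|y z [x1 [a1 [b1 h1]]] [x2 [a2 [b2 h2]]]|w].
- by exists 0, 0, 0; rewrite shom0 !raddf0 !addr0 raddf0.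
- exists (x1 - x2), (a1 - a2), (b1 - b2).
  have -> : f 3 (x1 - x2) + list_chain (a1 - a2) + edge_cells (b1 - b2) =
      (f 3 x1 + list_chain a1 + edge_cells b1) - (f 3 x2 + list_chain a2 + edge_cells b2).
    by rewrite !raddfB !opprD [in RHS]addrACA; congr (_ + _); rewrite [in RHS]addrACA.
  by rewrite raddfB [in RHS]raddfB /= h1 h2.
case: w => [x|c s|c s].
- by exists (gen x), 0, 0; rewrite plus_inclE !raddf0 !addr0.
- exists 0, 0, 0; rewrite shom0 !raddf0 !addr0 raddf0 -[s]dcomp1l.
  by rewrite -[S2 _ _]/(simplices_act s (S2 c (did 2))) -simplex_chain_act cls_act.
have [/dmap_inj_id ->|sI] := pselect (injective s); last first.
  exists 0, 0, 0; rewrite shom0 !raddf0 !addr0 raddf0 -[s]dcomp1l.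
  by rewrite -[S3 _ _]/(simplices_act s (S3 c (did 3))) -simplex_chain_act cls_act_noninj.
case: c => [u|e].
  by exists 0, (zgen u), 0; rewrite shom0 add0r raddf0 addr0 /list_chain zliftE.
by exists 0, 0, (gen e); rewrite shom0 raddf0 addr0 add0r edge_cellsE.
Qed.

Lemma tri_chain_bounds c : exists u, bounds (tri_chain c - incl2 u).
Proof.
have b0 (b : B 2) : b = 0 -> bounds b by move=> ->; apply: bounds0; rewrite raddf0.
case: c => [x|[v|[l s]]].
- by exists (gen x, 0); apply: b0; rewrite incl2E raddf0 addr0 plus_inclE subrr.
- by exists (0, gen v); apply: b0; rewrite incl2E shom0 add0r vertex_chainE subrr.
- by exists (word_sum (l :: s)); apply: (@word_chain_bounds _ word (l :: s)).
Qed.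

(** The 2-cells of words are homologous to combinations of 2-simplices of [X] and
    of vertex cells. *)
Lemma plus_chain2 (y : B 2) : exists u, bounds (y - incl2 u).
Proof.
have i0 : incl2 0 = 0 := zmod_morphism0 (@incl2_zmod _ _).
move: y; apply: plus_chain_ind => [|a b [u ha] [v hb]|w].
- by exists 0; rewrite i0 subr0; apply: bounds0; rewrite raddf0.
- by exists (u - v); rewrite incl2_zmod opprD addrACA -opprD; apply: boundsB.
case: w => [x|c s|c s]; first exact: (tri_chain_bounds (inl x)).
- have [/dmap_inj_id ->|sI] := pselect (injective s).
    exact: (tri_chain_bounds (inr c)).
  exists 0; rewrite i0 subr0 -[s]dcomp1l; apply: bounds0.
  by rewrite -[S2 _ _]/(simplices_act s (S2 c (did 2))) -simplex_chain_act cls_act_noninj.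
- have [/dmap_inj_cof[j ->]|sI] := pselect (injective s).
    rewrite /simplex_chain simplex_cl_face3.
    exact: tri_chain_bounds.
  exists 0; rewrite i0 subr0 -[s]dcomp1l; apply: bounds0.
  by rewrite -[S3 _ _]/(simplices_act s (S3 c (did 3))) -simplex_chain_act cls_act_noninj.
Qed.

(** The three components detect the coefficients of a 3-chain: the second finds the
    boundary of the edge chain [b], which makes [b] recoverable from the first
    (see [edge_fill_cycle]), and the third then gives [a]. *)
Lemma code2_chain3 (x : A 3) a b :
  code2_hom (bd (f 3 x + list_chain a + edge_cells b)) =
  (cls (bd x + edge_fill b), bd b, a + edge_code b).
Proof.
have -> : bd (f 3 x + list_chain a + edge_cells b) =
    f 2 (bd x) + bd (list_chain a) + bd (edge_cells b).
  by rewrite !bdD shom_bd.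
rewrite !code2_homD code2_hom_incl code2_bd_list code2_bd_edge.
by congr (_, _, _); rewrite /= ?addr0 ?add0r // raddfD.
Qed.

(** An edge chain whose filling is a cycle up to degenerate chains is itself
    degenerate, because the boundary of its filling gives it back. *)
Lemma edge_fill_cycle (x : A 3) b : bd b = 0 -> cls (bd (bd x + edge_fill b)) = 0 -> cls b = 0.
Proof.
move=> b0; rewrite bdD raddfD /= cls_bd_bd add0r bd_edge_fill b0.
by rewrite (zmod_morphism0 coneB) subr0.
Qed.

Lemma plus_incl_weak_equiv : acyclic_at A 1 -> weak_equiv f.
Proof.
move=> H1; apply: quasi_iso_weak_equiv => [[|[|n]] z hz|n y hy].
- by move=> _; exists (cone z); rewrite bd_cone.
- by move=> _; apply: H1.
- case=> w; case: n z hz w => [|n] z hz w fw; last first.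
    have [x wx] := plus_chain_ge4 w (isT : 3 < n.+4)%N.
    exists x; apply/eqP; rewrite -subr_eq0 -raddfB; apply/eqP.
    apply: (@plus_incl_reflects _ word n.+3) => //.
    by rewrite shomB clsB fw (cls_bd_eq wx) shom_bd subrr.
  have [x [a [b wE]]] := plus_chain3 w.
  have := code2_hom_cls_eq fw; rewrite (code2_hom_cls_eq (cls_bd_eq wE)).
  rewrite code2_hom_incl code2_chain3 => zE.
  have z1 : cls z = cls (bd x + edge_fill b) := congr1 (fun u => u.1.1) zE.
  have b0 : bd b = 0 := esym (congr1 (fun u => u.1.2) zE).
  have {}b0 := edge_fill_cycle b0 (etrans (esym (cls_bd_eq z1)) hz).
  by exists x; rewrite z1 edge_fill_cls0 // addr0.
case: n y hy => [|[|[|[|n]]]] y hy.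
- by exists 0 => //; rewrite shom0 subr0 (plus_chain_low y) //; apply: bounds0; rewrite raddf0.
- exists 0; first exact: cycle0.
  by rewrite shom0 subr0 (plus_chain_low y) //; apply: bounds0; rewrite raddf0.
- have [[c k] hu] := plus_chain2 y.
  (* The 3-cells of [cone k] remove the vertex cells, and those of the boundary
     [m] of the remaining chain [c1] make it a cycle. *)
  pose c1 := c - edge_fill (cone k); pose m := bd c1.
  have m0 : bd m = 0 by apply/cls0_inj/cls_bd_bd.
  exists (c1 - edge_fill m).
    by rewrite /= bdB clsB bd_edge_fill m0 (zmod_morphism0 coneB) subr0 subrr.
  have h1 := edge_fill_bounds (cone k); have h2 := edge_fill_bounds m.
  rewrite bd_cone in h1; rewrite m0 in h2.
  have := boundsD (boundsD hu h1) h2.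
  suff -> : y - incl2 (c, k) + incl2 (edge_fill (cone k), k) + incl2 (edge_fill m, 0) =
    y - f 2 (c1 - edge_fill m) by [].
  have -> : f 2 (c1 - edge_fill m) = incl2 (c1 - edge_fill m, 0).
    by rewrite incl2E raddf0 addr0.
  rewrite -addrA -addrA -!incl2N -!incl2D; congr (_ + incl2 _).
  congr (_, _); rewrite /= ?oppr0 ?addr0 ?addNr //.
  by rewrite /c1 !opprD !opprK addrA.
- (* The codes of the boundary of [y] vanish, so [y] involves none of the cells. *)
  have [x [a [b yE]]] := plus_chain3 y.
  have := code2_hom_cls0 hy; rewrite (code2_hom_cls_eq (cls_bd_eq yE)) code2_chain3 => zE.
  have z1 : cls (bd x + edge_fill b) = 0 := congr1 (fun u : tri_val_type X => u.1.1) zE.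
  have b0 : bd b = 0 := congr1 (fun u : tri_val_type X => u.1.2) zE.
  have a0 : a + edge_code b = 0 := congr1 (fun u : tri_val_type X => u.2) zE.
  have {}b0 := edge_fill_cycle b0 (cls_bd0 z1).
  exists x; first by move: z1; rewrite edge_fill_cls0 // addr0.
  move: a0; rewrite edge_code_cls0 // addr0 => a0.
  apply: bounds0; rewrite clsB yE a0 edge_cells_cls0 // addr0 raddf0 addr0.
  by rewrite subrr.
- have [x yx] := plus_chain_ge4 y (isT : 3 < n.+4)%N.
  exists x.
    apply: (@plus_incl_reflects _ word n.+3) => //.
    by rewrite shom_bd -(cls_bd_eq yx).
  by apply: bounds0; rewrite clsB yx subrr.
Qed.

End PlusHomology.

Lemma word_sum_surj (X : psset) (u : Zt X 2 * Zt X 0%N) : exists s, word_sum s = u.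
Proof.
have cat (s t : seq (letter X)) : word_sum (s ++ t) = word_sum s + word_sum t.
  by rewrite /word_sum big_cat.
have neg (s : seq (letter X)) : exists t, word_sum t = - word_sum s.
  exists [seq (~~ l.1, l.2) | l <- s]; rewrite /word_sum big_map -sumrN.
  apply: eq_bigr => -[b x] _; rewrite /letter_sum /=; case: b => //=.
  by rewrite opprK.
have sub v w : (exists s : seq (letter X), word_sum s = v) ->
    (exists s : seq (letter X), word_sum s = w) -> exists s : seq (letter X), word_sum s = v - w.
  case=> s <- [t <-]; have [t' e] := neg t.
  by exists (s ++ t'); rewrite cat e.
have s0 : exists s : seq (letter X), word_sum s = 0 by exists [::]; rewrite /word_sum big_nil.
have one l : exists s : seq (letter X), word_sum s = letter_sum l.
  by exists [:: l]; rewrite /word_sum big_seq1.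
case: u => a k; have -> : (a, k) = (a, 0) - (0, - k) :> Zt X 2 * Zt X 0%N.
  by congr (_, _); rewrite /= ?subr0 ?sub0r ?opprK.
apply: (sub (_, _) (_, _)).
  move: a; apply: Zt_ind => [//|a b ha hb|x]; last exact: (one (true, inl x)).
  by have := sub _ _ ha hb; rewrite -[_ - _]/(a - b, 0 - 0) subr0.
move: (- k); apply: Zt_ind => {a k} [//|a b ha hb|x].
  by have := sub _ _ ha hb; rewrite -[_ - _]/(0 - 0, a - b) subr0.
exact: (one (true, inr x)).
Qed.

(** The section [cone] exists because [H_0 = 0]. Then [e - cone (bd e)] is a cycle,
    which bounds because [H_1 = 0], and a bounding chain is spelled by a word. *)
Lemma homology_one_connected (X : psset) : acyclic_at (Zt X) 0 -> acyclic_at (Zt X) 1 ->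
  exists (X' : psset) (f : psmap X X'), one_connected X' /\ weak_equiv (Zt_map f).
Proof.
move=> H0 H1.
have bd_degen (t : dmap 1 0) (v : X 0%N) : bd (gen (sact t v) : Zt X 1%N) = 0.
  by rewrite bd1E /= !Zt_actE -!sact_comp !(dmap_to0 (dcomp t _) (did 0)) subrr.
have /choice[c hc] : forall v : X 0%N, exists a : Zt X 1%N,
    bd a = gen v /\ (v = bpt X 0 -> a = 0).
  move=> v; have [->|vpt] := pselect (v = bpt X 0).
    by exists 0; rewrite raddf0 /= zcl_pt.
  by have [a /eqP] := H0 (gen v) Logic.I; rewrite -subr_eq0 -raddfB => /eqP/cls0_inj/eqP;
    rewrite subr_eq0 => /eqP ha; exists a.
have c0 : c (bpt X 0) = 0 by apply: (hc _).2.
pose cone : Zt X 0%N -> Zt X 1%N := zrlift c.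
have coneB : zmod_morphism cone by exact/zrlift_zmod.
have bd_cone a : bd (cone a) = a.
  move: a; apply: zred_ext => [a b|//|v]; first by rewrite coneB raddfB.
  by rewrite /cone zrliftE // (hc v).1.
have /choice[word hw] : forall e : X 1%N, exists s : seq (letter X),
    [/\ (word_sum s).2 = bd (gen e), cls (bd (word_sum s).1) = cls (gen e - cone (bd (gen e))) &
     (exists (t : dmap 1 0) v, e = sact t v) -> s = [::]].
  move=> e; have [[t [v ->]]|ndeg] := pselect (exists (t : dmap 1 0) v, e = sact t v).
    exists [::]; rewrite /word_sum big_nil bd_degen (zmod_morphism0 coneB) subr0 eta_nat.
    by split=> //; rewrite /= raddf0 raddf0 cls_act.
  have [|a ha] := H1 (gen e - cone (bd (gen e))).
    by rewrite /= raddfB /= bd_cone subrr raddf0.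
  by have [s hs] := word_sum_surj (a, bd (gen e)); exists s; rewrite hs.
exists (plus word), (plus_incl word); split; first exact: one_connected_plus.
apply: (@plus_incl_weak_equiv X word cone) => // [e|e|t v].
- by case: (hw e).
- by case: (hw e).
- by case: (hw (sact t v)) => _ _; apply; exists t, v.
Qed.

(** * Free simplicial abelian groups are cofibrant *)

Section TrivialFibration.
Variables (E B : sab) (p : shom E B).
Hypotheses (pfib : fibration p) (pweq : weak_equiv p).

(** Only horns with constant value zero are lifted along the fibration; the other
    horns are filled by the group structure. *)
Lemma lift_moore n (b : B n.+1) : (forall i, (i <= n)%N -> 'd_i b = 0) ->
  exists2 e : E n.+1, (forall i, (i <= n)%N -> 'd_i e = 0) & p n.+1 e = b.
Proof.
move=> b0.
pose u : smap (horn (ord_max : 'I_n.+2)) (U E) :=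
  @SMap (horn ord_max) (U E) (fun m _ => 0) (fun m k t _ => esym (raddf0 (sab_act t))).
have vP m k (t : dmap m k) (s : dmap k n.+1) :
  sab_act (dcomp s t) b = sab_act t (sab_act s b) by rewrite sab_act_comp.
pose v : smap (simp n.+1) (U B) := @SMap (simp n.+1) (U B) (fun m s => sab_act s b) vP.
have [|w wu wv] := @pfib n ord_max u v.
  apply: smap_ext => m [s hs] /=; rewrite shom0.
  case/existsP: hs => j /andP[jm /forallP sj].
  rewrite (dmap_factor_cof sj) sab_act_comp b0 ?raddf0 //.
  by move: jm; rewrite -val_eqE /=; have := ltn_ord j; lia.
have did1 : dcomp (did n.+1) (did n.+1) = did n.+1 by rewrite dcomp1l.
exists (w n.+1 (did n.+1)); last first.
  have := congr1 (fun q : smap (simp n.+1) (U B) => q n.+1 (did n.+1)) wv.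
  by rewrite /= sab_act_id.
move=> i hi; have hj : (i < n.+2)%N by lia.
have hh : in_horn (ord_max : 'I_n.+2) (cof n i).
  apply/existsP; exists (Ordinal hj); rewrite -val_eqE /= neq_ltn ltnS hi.
  by apply/forallP => k; rewrite -val_eqE /= cofE eq_sym neq_bump.
have := congr1 (fun q : smap (horn (ord_max : 'I_n.+2)) (U E) => q n (exist _ (cof n i) hh)) wu.
move=> /= <-; rewrite -[cof n i in RHS]dcomp1l.
exact: (esym (smap_nat w (cof n i) (did n.+1))).
Qed.

Lemma trivial_fibration_surj0 (b : B 0%N) : exists e, p 0%N e = b.
Proof.
(* In dimension 0 every simplex is a sphere. *)
have [x _ [w w0 w1]] := weak_equiv_sphere (y := b) pweq (fun m t h => False_ind _ (notF h)).
have [e _ ew] := lift_moore w0.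
by exists ('d_1 e + x); rewrite raddfD /= shom_nat ew w1 subrK.
Qed.

Definition compatible_faces (C : sab) n : (nat -> C n) -> Prop :=
  if n is m.+1 then fun c => forall i j, (i <= j <= m.+1)%N -> 'd_i (c j.+1) = 'd_j (c i)
  else fun=> True.

(** Moore's argument: the faces are corrected one after the other. *)
Lemma fill_top_horn (C : sab) n (c : nat -> C n) r : compatible_faces c -> (r <= n.+1)%N ->
  exists u : C n.+1, forall i, (i < r)%N -> 'd_i u = c i.
Proof.
move=> cc; elim: r => [|r IH] rn; first by exists 0.
have [u hu] := IH (ltnW rn); exists (u + 's_r (c r - 'd_r u)) => i.
rewrite ltnS leq_eqVlt raddfD /= => /orP[/eqP ->|ir].
  by rewrite act_ds_id // addrC subrK.
rewrite hu //; case: n c cc rn IH u hu => [|n] c cc rn IH u hu; first by lia.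
case: r rn ir {IH} hu => // r rn ir hu.
rewrite act_ds_lt; last by lia.
by rewrite raddfB /= cc ?act_dd ?hu ?subrr ?raddf0 ?addr0 //; lia.
Qed.

(** Filling a horn and lifting a Moore chain gives a lift [e3] of [b] with the
    right faces except the last one, which is wrong by a sphere [delta] over zero.
    Injectivity on homotopy groups gives a null-homotopy [k] of [delta]. It lies
    over a sphere of [B], and by surjectivity a sphere [l] of [E] and a Moore
    chain [q] correct [k] to a null-homotopy over zero. *)
Lemma trivial_fibration_boundary n (c : nat -> E n) (b : B n.+1) : compatible_faces c ->
  (forall i, (i <= n.+1)%N -> 'd_i b = p n (c i)) ->
  exists2 e : E n.+1, p n.+1 e = b & forall i, (i <= n.+1)%N -> 'd_i e = c i.
Proof.
move=> cc bc.
have [e1 he1] := fill_top_horn cc (leqnn n.+1).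
have [e2 e20 pe2] : exists2 e : E n.+1, (forall i, (i <= n)%N -> 'd_i e = 0) &
    p n.+1 e = b - p n.+1 e1.
  by apply: lift_moore => i hi; rewrite raddfB /= bc ?leqW // -shom_nat he1 ?ltnS // subrr.
pose e3 := e1 + e2.
have pe3 : p n.+1 e3 = b by rewrite raddfD /= pe2 addrC subrK.
have he3 i : (i <= n)%N -> 'd_i e3 = c i by move=> hi; rewrite raddfD /= e20 // he1 ?addr0.
pose delta := c n.+1 - 'd_n.+1 e3.
have pdelta : p n delta = 0 by rewrite raddfB /= shom_nat pe3 bc // subrr.
have sdelta : sphere0 delta.
  rewrite /delta; case: n c b cc bc e1 he1 e2 e20 pe2 e3 pe3 he3 {delta pdelta}
    => [|n] c b cc bc e1 he1 e2 e20 pe2 e3 pe3 he3; first by move=> m t.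
  apply: faces_sphere0 => i hi; rewrite raddfB /= act_dd // he3 //.
  by rewrite cc ?hi ?leqnn // subrr.
have [k k0 kdelta] : null delta.
  apply: (weak_equiv_null pweq) => //; rewrite pdelta.
  by exists 0 => [i hi|]; rewrite raddf0.
have spk : sphere0 (p n.+1 k).
  apply: faces_sphere0 => i; rewrite leq_eqVlt -shom_nat => /orP[/eqP ->|hi].
    by rewrite kdelta.
  by rewrite k0 ?shom0.
have [l sl [w w0 wl]] := weak_equiv_sphere pweq spk.
have [q q0 pq] := lift_moore w0.
exists (e3 + (k - l - 'd_n.+2 q)).
  by rewrite raddfD !raddfB /= [p _ ('d__ _)]shom_nat pq wl subrr addr0.
move=> i hi; rewrite raddfD /= !sab_actB (sphere0_face _ sl) subr0 act_dd // q0 // sab_act0 subr0.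
move: hi; rewrite leq_eqVlt => /orP[/eqP ->|hi]; last by rewrite he3 // k0 // addr0.
by rewrite kdelta addrC subrK.
Qed.

End TrivialFibration.

Section SkeletalLift.
Variables (X : psset) (E B : sab) (p : shom E B) (g : shom (Zt X) B).
Hypotheses (pfib : fibration p) (pweq : weak_equiv p).

Notation D i x := (sact (cof _ i) x).
Notation S i x := (sact (cod _ i) x).

Definition target n (x : X n) : B n := g n (zcl (bpt X n) x).

Lemma target_act m n (t : dmap m n) (x : X n) : target (sact t x) = sab_act t (target x).
Proof. by rewrite /target eta_nat shom_nat. Qed.

(** A lift defined on all simplices, required to be compatible with the
    projection and the simplicial operators up to dimension [k] only. *)
Record good_lift k (h : forall n, X n -> E n) : Prop := GoodLift {
  good_over : forall n (x : X n), (n <= k)%N -> p n (h n x) = target x;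
  good_d : forall n i (x : X n.+1), (n < k)%N -> (i <= n.+1)%N -> h n (D i x) = 'd_i (h _ x);
  good_s : forall n i (x : X n), (n < k)%N -> (i <= n)%N -> h n.+1 (S i x) = 's_i (h _ x);
  good_pt : h 0%N (bpt X 0) = 0 }.

Section Extension.
Variables (k : nat) (h : forall n, X n -> E n).
Hypothesis hk : good_lift k h.

(** [s_i y = s_j z] with [i < j] forces [y = s_(j-1) t] and [z = s_i t], so the
    value prescribed on a degenerate simplex is independent of its presentation. *)
Lemma degenerate_value i j (y z : X k) : (i <= j <= k)%N -> S i y = S j z ->
  's_i (h y) = 's_j (h z).
Proof.
case/andP=> ij jk yz; have [e|ne] := eqVneq i j.
  by subst j; rewrite -(sact_ds_id y jk) yz sact_ds_id.
case: j ij ne jk yz => [|j] ij ne jk yz; first by lia.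
case: k hk y z yz jk => [|k'] hk' y z yz jk; first by lia.
have zt : z = S i (D j.+1 y).
  by rewrite -[LHS](sact_dSs_id (i := j.+1)) // -yz sact_ds_gt //; lia.
have yt : y = S j (D j.+1 y).
  rewrite -[LHS](sact_ds_id (i := i)); last by lia.
  rewrite yz sact_ds_lt; last by lia.
  by rewrite {1}zt sact_ds_id //; lia.
move: (D j.+1 y) zt yt => t -> ->.
by rewrite (good_s hk'); [rewrite (good_s hk'); [apply: act_ss|..]|..]; lia.
Qed.

Lemma degenerate_face i j (y : X k) : (i <= k)%N -> (j <= k.+1)%N ->
  'd_j ('s_i (h y)) = h (D j (S i y)).
Proof.
move=> ik jk; have [->|ji] := eqVneq j i; first by rewrite act_ds_id // sact_ds_id.
have [->|ji1] := eqVneq j i.+1; first by rewrite act_dSs_id // sact_dSs_id.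
case: k hk y ik jk => [|k'] hk' y ik jk; first by lia.
have [lt|ge] := ltnP j i.
  case: i ik ji ji1 lt => // i ik ji ji1 lt.
  rewrite act_ds_lt; last by lia.
  rewrite sact_ds_lt; last by lia.
  by rewrite (good_s hk') ?(good_d hk') //; lia.
case: j jk ji ji1 ge => [|j] jk ji ji1 ge; first by lia.
rewrite act_ds_gt; last by lia.
rewrite sact_ds_gt; last by lia.
by rewrite (good_s hk') ?(good_d hk') //; lia.
Qed.

(** A nondegenerate simplex is constrained only by its boundary. *)
Lemma extend_at (x : X k.+1) : exists e : E k.+1,
  [/\ p k.+1 e = target x, forall i, (i <= k.+1)%N -> 'd_i e = h (D i x) &
   forall i (y : X k), (i <= k)%N -> x = S i y -> e = 's_i (h y)].
Proof.
have [[i [y [ik ->]]]|ndeg] := pselect (exists i (y : X k), (i <= k)%N /\ x = S i y).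
  exists ('s_i (h y)); split.
  - by rewrite shom_nat (good_over hk) // target_act.
  - by move=> j jk; apply: degenerate_face.
  - move=> j z jk yz; have [ij|/ltnW ji] := leqP i j.
      by apply: degenerate_value; rewrite ?ij.
    by apply/esym/degenerate_value; rewrite ?ji.
have [|i hi|e pe de] :=
  @trivial_fibration_boundary _ _ p pfib pweq k (fun i => h (D i x)) (target x).
- case: k hk x {ndeg} => // k' hk' x i j /= ij.
  by rewrite -!(good_d hk') ?sact_dd //; lia.
- by rewrite (good_over hk) // target_act.
exists e; split=> // i y ik xy; case: ndeg; exists i, y; split=> //.
Qed.

Definition update (u : X k.+1 -> E k.+1) n : X n -> E n :=
  if pselect (k.+1 = n) is left e then eq_rect k.+1 (fun n => X n -> E n) u n e else h (n := n).

Lemma update_same u : update u (n := k.+1) = u.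
Proof. by rewrite /update; case: pselect => // e; rewrite (Prop_irrelevance e erefl). Qed.

Lemma update_other u n : (n <= k)%N -> update u (n := n) = h (n := n).
Proof. by rewrite /update; case: pselect => // e; lia. Qed.

Lemma good_lift_extend : exists h' : forall n, X n -> E n,
  good_lift k.+1 h' /\ forall n (x : X n), (n <= k)%N -> h' n x = h x.
Proof.
have [u hu] := choice extend_at; exists (update u); split; last first.
  by move=> n x nk; rewrite update_other.
split.
- move=> n x; rewrite leq_eqVlt => /orP[/eqP e|nk].
    by subst n; rewrite update_same; case: (hu x).
  by rewrite update_other // (good_over hk).
- move=> n i x; rewrite ltnS leq_eqVlt => /orP[/eqP e|nk] hi.
    by subst n; rewrite update_same update_other //; case: (hu x) => _ ->.
  by rewrite !update_other ?(ltnW nk) // (good_d hk).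
- move=> n i x; rewrite ltnS leq_eqVlt => /orP[/eqP e|nk] hi.
    by subst n; rewrite update_same update_other //; case: (hu (S i x)) => _ _; apply.
  by rewrite !update_other ?(ltnW nk) // (good_s hk).
- by rewrite update_other // (good_pt hk).
Qed.

End Extension.

Lemma good_lift0 : exists h : forall n, X n -> E n, good_lift 0 h.
Proof.
have /choice[u hu] : forall x : X 0%N, exists e : E 0%N,
    p 0%N e = target x /\ (x = bpt X 0 -> e = 0).
  move=> x; have [->|xpt] := pselect (x = bpt X 0).
    by exists 0; rewrite /target zcl_pt !shom0.
  by have [e pe] := trivial_fibration_surj0 pfib pweq (target x); exists e.
exists (fun n => if n is 0 then u else fun=> 0); split=> //; last exact: (hu _).2.
by case=> // x _; apply: (hu x).1.
Qed.

Lemma lift_exists : exists h : forall n, X n -> E n, forall k, good_lift k h.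
Proof.
have next k (s : {h | good_lift k h}) :
    {s' : {h | good_lift k.+1 h} | forall n (x : X n), (n <= k)%N -> sval s' n x = sval s n x}.
  case: s => h hk; have [h' [gh' e]] := cid (good_lift_extend hk).
  by exists (exist _ h' gh').
pose stage := fix stage k : {h | good_lift k h} :=
  if k is k'.+1 then sval (next k' (stage k')) else cid good_lift0.
have stable d n (x : X n) : sval (stage (n + d)%N) n x = sval (stage n) n x.
  elim: d => [|d <-]; first by rewrite addn0.
  by rewrite addnS /=; apply: (svalP (next _ _)); rewrite leq_addr.
pose h n (x : X n) := sval (stage n) n x.
have hE k n (x : X n) : (n <= k)%N -> sval (stage k) n x = h n x.
  by move=> nk; rewrite -(subnKC nk) stable.
exists h => k; split.
- by move=> n x _; rewrite /h (good_over (svalP (stage n))).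
- move=> n i x _ hi; rewrite -(hE n.+1 n _ (leqnSn n)) -(hE n.+1 n.+1 _ (leqnn _)).
  by rewrite (good_d (svalP (stage n.+1))).
- move=> n i x _ hi; rewrite -(hE n.+1 n _ (leqnSn n)) -(hE n.+1 n.+1 _ (leqnn _)).
  by rewrite (good_s (svalP (stage n.+1))).
- exact: (good_pt (svalP (stage 0%N))).
Qed.

Lemma Zt_lift : exists f : shom (Zt X) E, shom_comp p f = g.
Proof.
have [h hh] := lift_exists.
have h_nat m n (t : dmap m n) : forall x : X n, h m (sact t x) = sab_act t (h n x).
  move: m n t; apply: dmap_ind => [n x|m n i t hi IH x|m n i t hi IH x].
  - by rewrite sact_id sab_act_id.
  - by rewrite sact_comp IH (good_d (hh n.+1)) // sab_act_comp.
  - by rewrite sact_comp (good_s (hh m.+1)) // IH sab_act_comp.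
have h_pt n : h n (bpt X n) = 0.
  by rewrite -(@bpt_act X _ _ (dconst n)) h_nat (good_pt (hh 0%N)) sab_act0.
pose f n : Zt X n -> E n := zrlift (h n).
have fB n : zmod_morphism (f n) by exact: zrlift_zmod.
have fE n x : f n (zcl (bpt X n) x) = h n x by exact: zrliftE.
have f_nat m n (t : dmap m n) x : f m (sab_act t x) = sab_act t (f n x).
  move: x; apply: zred_ext => [a b|a b|x].
  - by rewrite sab_actB fB.
  - by rewrite fB sab_actB.
  - by rewrite -eta_nat !fE h_nat.
exists (SHom fB f_nat); apply: Zt_ext => n x.
by rewrite shom_compE /= fE (good_over (hh n)).
Qed.

End SkeletalLift.

Lemma cofibrant_Zt (X : psset) : cofibrant (Zt X).
Proof. by move=> E B p pfib pweq g; apply: Zt_lift. Qed.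

(** * Strict coalgebra maps are derived coalgebra maps *)

Section Projection.
Variables (A : sab) (k : nat).

Definition tproj_fun n : Tsimp A k n -> A n :=
  tlift (fun a : A n => zlift (fun _ : dmap n k => a)).

Lemma tproj_l n z : zmod_morphism (fun a : A n => zlift (fun _ : dmap n k => a) z).
Proof.
move=> a b; move: z; apply: zab_ext; first exact: zlift_zmod.
  by move=> u v; rewrite !zlift_zmod !opprD addrACA.
by move=> s; rewrite !zliftE.
Qed.

Lemma tproj_funE n (a : A n) (s : dmap n k) : tproj_fun (tsimp a s) = a.
Proof.
rewrite /tproj_fun /tsimp tliftE ?zliftE //; first exact: tproj_l.
by move=> b; apply: zlift_zmod.
Qed.

Lemma tproj_zmod n : zmod_morphism (@tproj_fun n).
Proof. by apply: tlift_zmod; [apply: tproj_l|move=> a; apply: zlift_zmod]. Qed.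

Lemma tproj_nat m n (t : dmap m n) x : tproj_fun (sab_act t x) = sab_act t (tproj_fun x).
Proof.
move: x; apply: tens_zab_ext.
- exact: (zmod_morphism_comp (@tproj_zmod m) (@sab_actB (Tsimp A k) _ _ t)).
- exact: (zmod_morphism_comp (@sab_actB A _ _ t) (@tproj_zmod n)).
by move=> a s; rewrite -/(tsimp a s) tsimp_act !tproj_funE.
Qed.

Definition tproj : shom (Tsimp A k) A := SHom tproj_zmod tproj_nat.

Lemma tprojE n (a : A n) (s : dmap n k) : tproj n (tsimp a s) = a.
Proof. exact: tproj_funE. Qed.

End Projection.

Definition const_hom A B (g : shom A B) k : Hom A B k := shom_comp g (tproj A k).

Lemma const_homE A B (g : shom A B) k n (a : A n) (s : dmap n k) :
  const_hom g k n (tsimp a s) = g n a.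
Proof. by rewrite /const_hom shom_compE tprojE. Qed.

Lemma const_hom_act A B (g : shom A B) k l (t : dmap k l) :
  const_hom g k = sact t (const_hom g l).
Proof.
rewrite -[RHS]/(shom_comp (const_hom g l) (Tsimp_map (shom_id A) t)).
by apply: Tsimp_ext => n a s; rewrite shom_compE Tsimp_mapE !const_homE.
Qed.

Lemma K_simp_const A B (g : shom A B) k : K_simp (const_hom g k) = const_hom (K_map g) k.
Proof.
by apply: TsimpK_ext => n a s; rewrite shom_compE strengthE !(K_mapE, const_homE).
Qed.

Definition const_simplex A B (g : shom A B) n : smap (simp n) (Hom A B) :=
  @SMap (simp n) (Hom A B) (fun m _ => const_hom g m) (fun m k t _ => const_hom_act g t).

Lemma K_map_id A : K_map (shom_id A) = shom_id (K A).
Proof. by apply: K_ext => n x; rewrite K_mapE. Qed.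

Fixpoint iter_coact (Y : coalg) n : shom Y (Kn n Y) :=
  if n is m.+1 then shom_comp (K_map (iter_coact Y m)) (coact Y) else shom_id Y.

(** Coassociativity moves the comultiplication on any copy of [K] past the
    iterated coaction. *)
Lemma iter_coact_coface (Y : coalg) n i :
  shom_comp (Kn_coface Y n i) (iter_coact Y n) = iter_coact Y n.+1.
Proof.
elim: n i => [|n IH] [|i] /=.
- by rewrite K_map_id shom_comp1r shom_comp1l.
- by rewrite K_map_id shom_comp1r shom_comp1l.
- by rewrite shom_compA comult_nat -shom_compA -coact_assoc shom_compA -K_map_comp.
- by rewrite shom_compA -K_map_comp IH.
Qed.

Section StrictMap.
Variables (Y Y' : coalg) (g : shom Y Y').
Hypothesis gP : shom_comp (K_map g) (coact Y) = shom_comp (coact Y') g.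

Lemma strict_coface n (i : 'I_n.+2) :
  smap_comp (const_simplex (shom_comp (iter_coact Y' n.+1) g) n.+1) (simp_map (dcoface i)) =
  smap_comp (cobar_coface Y Y' i) (const_simplex (shom_comp (iter_coact Y' n) g) n).
Proof.
apply: smap_ext => m s; rewrite /= /cobar_coface; case: eqP => _ /=.
  rewrite /cobar_d0_fun K_simp_const; apply: Tsimp_ext => k a t.
  rewrite const_homE [RHS]shom_compE Tsimp_mapE const_homE K_map_comp.
  by have /= := congr1 (fun h : shom Y (K Y') => K_map (iter_coact Y' n) k (h k a)) gP.
have /= <- := iter_coact_coface Y' n i.-1; apply: Tsimp_ext => k a t.
by rewrite const_homE [RHS]shom_compE const_homE.
Qed.

(** The cofaces of the vertex [m^n o g] all agree by coassociativity, so the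
    constant simplices at these vertices form a map of restricted diagrams. *)
Definition strict_derived : derived_map Y Y' := @RCoMap Delta_rc (cobar Y Y') _ strict_coface.

Lemma underlying_strict : underlying strict_derived = g.
Proof. by apply: shom_ext => n y; rewrite /= tproj_funE. Qed.

End StrictMap.

(** * Comonadicity *)

Section Grouplike.
Variable Y : coalg.

Definition grouplike n (y : Y n) : Prop := coact Y n y = K_cl y.

Lemma grouplike_act m n (t : dmap m n) (y : Y n) : grouplike y -> grouplike (sab_act t y).
Proof. by rewrite /grouplike shom_nat => ->; rewrite K_cl_act. Qed.

Definition grouplike_simplex n : Type := {y : Y n | grouplike y}.

Lemma grouplike_ext n (a b : grouplike_simplex n) : sval a = sval b -> a = b.
Proof.
by case: a b => [a ha] [b hb] /= ab; case: _ / ab hb => hb; rewrite (Prop_irrelevance ha hb).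
Qed.

Definition grouplike_sact m n (t : dmap m n) (a : grouplike_simplex n) : grouplike_simplex m :=
  exist _ (sab_act t (sval a)) (grouplike_act t (svalP a)).

Lemma grouplike_sact_id n a : grouplike_sact (did n) a = a.
Proof. by apply: grouplike_ext; rewrite /= sab_act_id. Qed.

Lemma grouplike_sact_comp m n p (g : dmap n p) (f : dmap m n) a :
  grouplike_sact (dcomp g f) a = grouplike_sact f (grouplike_sact g a).
Proof. by apply: grouplike_ext; rewrite /= sab_act_comp. Qed.

Definition grouplike_sset : sset := SSet grouplike_sact_id grouplike_sact_comp.

Lemma grouplike0 n : grouplike (0 : Y n).
Proof. by rewrite /grouplike shom0 /K_cl zcl_pt. Qed.

Lemma grouplike_pt_act m n (t : dmap m n) :
  sact t (exist _ 0 (grouplike0 n) : grouplike_sset n) = exist _ 0 (grouplike0 m).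
Proof. by apply: grouplike_ext; rewrite /= sab_act0. Qed.

Definition grouplikes : psset := PSSet grouplike_pt_act.

Notation X := grouplikes.

Definition grouplike_incl_fun n : Zt X n -> Y n := zrlift (fun a : X n => sval a).

Lemma grouplike_inclE n (a : X n) : grouplike_incl_fun (gen a) = sval a.
Proof. exact: zrliftE. Qed.

Lemma grouplike_incl_zmod n : zmod_morphism (@grouplike_incl_fun n).
Proof. exact: zrlift_zmod. Qed.

Lemma grouplike_incl_nat m n (t : dmap m n) x :
  grouplike_incl_fun (sab_act t x) = sab_act t (grouplike_incl_fun x).
Proof.
move: x; apply: zred_ext => [a b|a b|a].
- by rewrite sab_actB grouplike_incl_zmod.
- by rewrite grouplike_incl_zmod sab_actB.
- by rewrite -eta_nat !grouplike_inclE.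
Qed.

Definition grouplike_incl : shom (chains X) Y := SHom grouplike_incl_zmod grouplike_incl_nat.

Lemma grouplike_incl_coalg :
  shom_comp (K_map grouplike_incl) (coact (chains X)) = shom_comp (coact Y) grouplike_incl.
Proof.
apply: Zt_ext => n a; rewrite !shom_compE [coact (chains _)]/= chains_coactE K_mapE /=.
by rewrite grouplike_inclE (svalP a).
Qed.

(** The projection of [K Y] to the span of the classes of grouplike elements, with
    [other_part] the complementary projection. *)
Definition grouplike_part n : K Y n -> Zt X n :=
  zrlift (fun y : Y n => if pselect (grouplike y) is left e then gen (exist _ y e : X n) else 0).

Lemma grouplike_part_pt n :
  (if pselect (grouplike (0 : Y n)) is left e then gen (exist _ 0 e : X n) else 0) = 0.
Proof.
case: pselect => // e; rewrite (_ : exist _ 0 e = bpt X n) ?zcl_pt //.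
exact: grouplike_ext.
Qed.

Lemma grouplike_partE n (y : Y n) : grouplike_part (K_cl y) =
  if pselect (grouplike y) is left e then gen (exist _ y e : X n) else 0.
Proof. exact/zrliftE/grouplike_part_pt. Qed.

Lemma grouplike_part_zmod n : zmod_morphism (@grouplike_part n).
Proof. exact/zrlift_zmod/grouplike_part_pt. Qed.

Definition other_part n : K Y n -> K Y n :=
  zrlift (fun y : Y n => if pselect (grouplike y) then 0 else K_cl y).

Lemma other_part_pt n : (if pselect (grouplike (0 : Y n)) then 0 else K_cl 0) = 0 :> K Y n.
Proof. by case: pselect => // -[]; apply: grouplike0. Qed.

Lemma other_partE n (y : Y n) :
  other_part (K_cl y) = if pselect (grouplike y) then 0 else K_cl y.
Proof. exact/zrliftE/other_part_pt. Qed.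

Lemma other_part_zmod n : zmod_morphism (@other_part n).
Proof. exact/zrlift_zmod/other_part_pt. Qed.

Definition nongenerators n : K (K Y) n -> K Y n :=
  zrlift (fun z : K Y n => if pselect (z = K_cl (counit Y n z)) then 0 else K_cl (counit Y n z)).

Lemma nongenerators_pt n :
  (if pselect (0 = K_cl (counit Y n 0)) then 0 else K_cl (counit Y n 0)) = 0 :> K Y n.
Proof. by case: pselect => // ne; case: ne; rewrite shom0 /K_cl zcl_pt. Qed.

Lemma nongeneratorsE n (z : K Y n) : nongenerators (K_cl z) =
  if pselect (z = K_cl (counit Y n z)) then 0 else K_cl (counit Y n z).
Proof. exact/zrliftE/nongenerators_pt. Qed.

Lemma nongenerators_zmod n : zmod_morphism (@nongenerators n).
Proof. exact/zrlift_zmod/nongenerators_pt. Qed.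

Lemma counit_coact n (y : Y n) : counit Y n (coact Y n y) = y.
Proof. by have := congr1 (fun h : shom Y Y => h n y) (coact_counit Y). Qed.

(** Write [m y] as a combination of classes [[y_i]]. Coassociativity equates the
    combinations of [[m y_i]] and of [[[y_i]]]; applying
    [nongenerators], which drops the arguments that are themselves classes, leaves
    the [y_i] that are not grouplike on the one side and nothing on the other. *)
Lemma other_part_coact n (y : Y n) : other_part (coact Y n y) = 0.
Proof.
have e1 z : nongenerators (K_map (coact Y) n z) = other_part z.
  move: z; apply: zred_ext => [a b|a b|x].
  - by rewrite shomB nongenerators_zmod.
  - exact: other_part_zmod.
  rewrite -/(K_cl x) K_mapE nongeneratorsE other_partE counit_coact.
  by rewrite /grouplike; case: pselect.
have e2 z : nongenerators (comult Y n z) = 0.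
  move: z; apply: zred_ext => [a b|a b|x]; last 1 first.
  - rewrite -/(K_cl x) comultE nongeneratorsE (_ : counit Y n (K_cl x) = x) //.
      by case: pselect.
    exact: counit_funE.
  - by rewrite shomB nongenerators_zmod.
  - by rewrite subrr.
have := congr1 (fun h : shom Y (K (K Y)) => nongenerators (h n y)) (coact_assoc Y).
by rewrite !shom_compE e1 e2.
Qed.

(** The grouplike part recovers [z] under the counit up to the other part; for
    [z = m y] the latter vanishes, which writes [y] in grouplike elements. *)
Lemma counit_parts n (z : K Y n) :
  counit Y n z = grouplike_incl_fun (grouplike_part z) + counit Y n (other_part z).
Proof.
move: z; apply: zred_ext => [a b|a b|x].
- exact: shomB.
- by rewrite grouplike_part_zmod grouplike_incl_zmod other_part_zmod shomB opprD addrACA.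
rewrite -/(K_cl x) grouplike_partE other_partE; case: pselect => [e|ne].
  by rewrite grouplike_inclE shom0 addr0; apply: counit_funE.
by rewrite (zmod_morphism0 (@grouplike_incl_zmod n)) add0r.
Qed.

Definition grouplike_coord_fun n (y : Y n) : Zt X n := grouplike_part (coact Y n y).

Lemma grouplike_coordK n : cancel (@grouplike_coord_fun n) (grouplike_incl n).
Proof.
move=> y; rewrite -[RHS]counit_coact counit_parts other_part_coact shom0 addr0.
by [].
Qed.

Lemma grouplike_inclK n : cancel (grouplike_incl n) (@grouplike_coord_fun n).
Proof.
apply: zred_ext => [a b|//|a].
  by rewrite shomB /grouplike_coord_fun shomB grouplike_part_zmod.
rewrite /grouplike_coord_fun /= grouplike_inclE (svalP a) grouplike_partE.
case: pselect => [e|[]]; last exact: (svalP a).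
by congr (zcl _ _); apply: grouplike_ext.
Qed.

Lemma grouplike_coord_zmod n : zmod_morphism (@grouplike_coord_fun n).
Proof. by move=> a b; rewrite /grouplike_coord_fun shomB grouplike_part_zmod. Qed.

Lemma grouplike_coord_nat m n (t : dmap m n) y :
  grouplike_coord_fun (sab_act t y) = sab_act t (grouplike_coord_fun y).
Proof.
by apply: (can_inj (@grouplike_inclK m)); rewrite grouplike_coordK shom_nat grouplike_coordK.
Qed.

Definition grouplike_coord : shom Y (chains X) := SHom grouplike_coord_zmod grouplike_coord_nat.

Lemma grouplike_incl_weak_equiv : weak_equiv grouplike_incl.
Proof.
exact: (inverse_weak_equiv (h := grouplike_coord) grouplike_inclK grouplike_coordK).
Qed.

End Grouplike.

(** * Equivalences through derived coalgebra maps *)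

Lemma strict_step (Y Y' : coalg) (g : shom Y Y') : cofibrant Y -> cofibrant Y' ->
  shom_comp (K_map g) (coact Y) = shom_comp (coact Y') g -> weak_equiv g ->
  derived_step Y Y'.
Proof.
move=> cY cY' gP gw; split=> //; exists (strict_derived gP).
by rewrite /derived_weak_equiv underlying_strict.
Qed.

Lemma derived_equivalent_acyclic_at (Y Y' : coalg) n : derived_equivalent Y Y' ->
  acyclic_at Y n <-> acyclic_at Y' n.
Proof.
elim=> [a b [_ _ [f fw]]|a|a b _ IH|a b c _ IH1 _ IH2].
- exact: weak_equiv_acyclic_at fw.
- by [].
- by rewrite IH.
- by rewrite IH1.
Qed.

Lemma chains_map_coalg (X X' : psset) (f : psmap X X') :
  shom_comp (K_map (Zt_map f)) (coact (chains X)) = shom_comp (coact (chains X')) (Zt_map f).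
Proof.
have fE n x : Zt_map f n (zcl (bpt X n) x) = zcl (bpt X' n) (f n x) := Zt_map_funE f x.
apply: Zt_ext => n x; rewrite !shom_compE [coact (chains X)]/= [coact (chains X')]/=.
by rewrite chains_coactE K_mapE fE chains_coactE.
Qed.

Theorem theorem1p9 (Y : coalg) (hY : cofibrant Y) :
  (exists X : psset, one_connected X /\ derived_equivalent Y (chains X)) <->
  one_connected (U Y).
Proof.
rewrite one_connected_sab; split=> [[X [/one_connected_Zt[h0 h1] e]]|[h0 h1]].
  by split; apply/(derived_equivalent_acyclic_at _ e).
have jw := @grouplike_incl_weak_equiv Y.
have [||X' [f [X'1 fw]]] := @homology_one_connected (grouplikes Y).
- exact/(weak_equiv_acyclic_at _ jw).
- exact/(weak_equiv_acyclic_at _ jw).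
exists X'; split=> //; apply: (@rst_trans _ _ _ (chains (grouplikes Y))).
  apply/rst_sym/rst_step; apply: (strict_step (g := @grouplike_incl Y)) => //.
    exact: cofibrant_Zt.
  exact: grouplike_incl_coalg.
apply/rst_step/(@strict_step (chains (grouplikes Y)) (chains X') (Zt_map f)) => //.
- exact: cofibrant_Zt.
- exact: cofibrant_Zt.
- exact: chains_map_coalg.
Qed.
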